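(* Let $K$ be a compact Hausdorff abelian topological group and let $H$ be a countable subgroup of $K$. Then $H$ is $\mathfrak{g}$-closed in $K$, i.e. $\mathfrak{g}_K(H)=H$.
   Context: $\mathbb{T}=\mathbb{R}/\mathbb{Z}$. For an abelian topological group $G$, $\hat G$ denotes its Pontryagin dual (the group of continuous homomorphisms $G\to\mathbb{T}$). For a sequence $\underline u=(u_n)$ in $\hat G$ put $s_{\underline u}(G)=\{x\in G\mid u_n(x)\longrightarrow 0 \text{ in } \mathbb{T}\}$. For a subgroup $H\leq G$ put $$\mathfrak{g}_G(H)=\bigcap\{s_{\underline u}(G)\mid \underline u\in \hat G^{\mathbb{N}},\ H\leq s_{\underline u}(G)\}.$$ $H$ is called $\mathfrak{g}$-closed in $G$ if $\mathfrak{g}_G(H)=H$. *)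

(* Defs.v *)
From HB Require Import structures.
From mathcomp Require Import all_boot all_order all_algebra.
From mathcomp Require Import generic_quotient ring_quotient.
From mathcomp Require Import all_classical all_reals all_analysis.

Set Implicit Arguments.
Unset Strict Implicit.
Unset Printing Implicit Defensive.

Import Order.TTheory GRing.Theory Num.Theory.
Import numFieldNormedType.Exports.

Local Open Scope classical_set_scope.
Local Open Scope quotient_scope.
Local Open Scope ring_scope.

(* The circle group T = R/Z: the quotient of the additive group of R by the
   subgroup of its integers, with the quotient topology. *)
Definition int_subgroup (R : realType) : zmodClosed R :=
  GRing.ZmodClosed.clone R (@Num.int_num_subdef R) _.

Definition circle (R : realType) : Type := {ideal_quot (int_subgroup R)}.

HB.instance Definition _ (R : realType) := GRing.Zmodule.on (circle R).
HB.instance Definition _ (R : realType) := Quotient.on (circle R).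

Section circle_topology.
Context (R : realType).
Local Notation T := (circle R).

Lemma pi_circle0 : \pi_T 0 = 0. Proof. by rewrite piE. Qed.

Lemma pi_circleD (x y : R) : \pi_T (x + y) = \pi_T x + \pi_T y.
Proof. by rewrite piE. Qed.

Lemma pi_circleN (x : R) : \pi_T (- x) = - \pi_T x.
Proof. by rewrite piE. Qed.

Lemma pi_circle_eq (x y : R) : (\pi_T x == \pi_T y) = (x - y \is a Num.int).
Proof. by rewrite -Quotient.idealrBE. Qed.

(* [quotient_topology] is not reused because its choice structure differs from
   the one underlying the group structure of the quotient, so that the two
   would not form a common topologicalZmodType. *)
Definition circle_open (U : set T) := open (\pi_T @^-1` U).

Fact circle_openT : circle_open setT.
Proof. by rewrite /circle_open preimage_setT; exact: openT. Qed.

Fact circle_openI : setI_closed circle_open.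
Proof. by move=> A B; exact: openI. Qed.

Fact circle_open_bigcup (I : Type) (f : I -> set T) :
  (forall i, circle_open (f i)) -> circle_open (\bigcup_i f i).
Proof. by move=> of_; apply: bigcup_open => i _; exact: of_. Qed.

HB.instance Definition _ :=
  isOpenTopological.Build T circle_openT circle_openI circle_open_bigcup.

Lemma pi_circle_continuous : continuous (\pi_T : R -> T).
Proof. exact/continuousP. Qed.

Lemma pi_circle_open (A : set R) : open A -> open (\pi_T @` A : set T).
Proof.
move=> oA; rewrite /open/= /circle_open.
rewrite (_ : _ @^-1` _ =
    \bigcup_(z in [set z : R | z \is a Num.int]) ((fun x => x - z) @^-1` A)).
  apply: bigcup_open => z _; apply: open_comp => // x _.
  by apply: continuousB; [exact: cvg_id|exact: cvg_cst].
apply/seteqP; split=> [x /= [a Aa ax]|x [z /= zint Axz]].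
  exists (x - a); last by rewrite /= opprB addrCA subrr addr0.
  by rewrite /= -pi_circle_eq ax.
exists (x - z) => //; apply/eqP; rewrite pi_circle_eq.
by rewrite addrAC subrr sub0r rpredN.
Qed.

Lemma pi_circle_nbhs (x : R) (A : set R) :
  nbhs x A -> nbhs (\pi_T x : T) (\pi_T @` A : set T).
Proof.
rewrite nbhsE => -[B [oB Bx] BA].
apply: filterS (image_subset (\pi_T : R -> T) BA) _.
apply: open_nbhs_nbhs; split.
  exact: pi_circle_open.
by exists x.
Qed.

Fact circle_sub_continuous : continuous (fun x : T * T => x.1 - x.2).
Proof.
move=> [x y] U /=; rewrite -(reprK x) -(reprK y).
set a := repr x; set b := repr y; rewrite -pi_circleN -pi_circleD => Uab.
have : nbhs (a, b) ((fun z : R * R => z.1 - z.2) @^-1` (\pi_T @^-1` U)).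
  by apply: (@sub_continuous R^o (a, b)); exact: pi_circle_continuous Uab.
case=> -[A B] /= [nA nB] AB.
exists (\pi_T @` A, \pi_T @` B); first by split; exact: pi_circle_nbhs.
move=> [_ _] /= [[c Ac <-] [d Bd <-]].
by rewrite -pi_circleN -pi_circleD; exact: (AB (c, d)).
Qed.

HB.instance Definition _ :=
  PreTopologicalNmodule_isTopologicalZmodule.Build T circle_sub_continuous.

End circle_topology.

Section gclosure.
Context (R : realType) (G : topologicalZmodType).

(* The underlying set of the Pontryagin dual, as a subset of the group of all
   maps from G to the circle with pointwise operations. *)
Definition dual : set (G -> circle R) :=
  [set f | continuous f /\ {morph f : x y / x + y}].

Lemma dual_zmod_closed : zmod_closed [in dual].
Proof.
split=> [|f g]; rewrite !inE.
  split=> [|x y]; last exact: esym (addr0 0).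
  by move=> x; exact: (@cst_continuous G (circle R) 0 x).
move=> [cf fD] [cg gD]; split=> [x|x y]; last first.
  by rewrite /= !fctE fD gD opprD addrACA.
apply: (@continuous_comp _ _ _ (fun x => (f x, g x))
  (fun z : circle R * circle R => z.1 - z.2)); last exact: sub_continuous.
exact: (cvg_pair (cf x) (cg x)).
Qed.

Definition s_set (u : nat -> G -> circle R) : set G :=
  [set x | u n x @[n --> \oo] --> (0 : circle R)].

Definition gclosure (H : set G) : set G :=
  \bigcap_(u in [set u | (forall n, dual (u n)) /\ H `<=` s_set u]) s_set u.

Definition gclosed (H : set G) : Prop := gclosure H = H.

End gclosure.

(* Main.v *)
Require Import Defs.
From mathcomp Require Import all_boot all_order all_algebra.
From mathcomp Require Import generic_quotient.
From mathcomp Require Import all_classical all_reals all_analysis.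
From mathcomp Require Import ring lra.
From mathcomp Require complex.

(* Since the circle is divisible, for [x] outside [H] there is a (discontinuous)
   homomorphism [chi : K -> R/Z] with [chi H = 0] and [chi x <> 0].  As [H] is
   countable, it is enough to approximate [chi] by continuous characters on
   every finite subset [l] of [K]; neither Haar measure nor the Peter-Weyl
   theorem is needed for this.

   By divisibility again, the average over suitable finite families of
   homomorphisms [u] of a trigonometric polynomial [sum_a c_a e(u(y_a))] is
   exactly its coefficient at [0] (the sum of the [c_a] with [y_a = 0]); so the
   polynomial is positive at some [u] as soon as this coefficient is positive.
   Take a continuous bump function [f] at [0] and
   - [kap], a nonnegative kernel concentrated on the [u] close to [chi] on [l];
   - [phi(u)], the average of [f(x) e(u(x))] for [x] in a Folner box of [K];
   - [Phi(u)], the sum of [f(z) e(u(z))] for [z] in a finite set of small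
     doubling, which exists by polynomial growth of the boxes.
   The coefficient at [0] of [(kap - s) |phi|^2 |Phi|^2 - d^2 |Phi|^2] is positive
   for constants [s], [d] depending only on [l] and [f], whence a [u] close to
   [chi] on [l] with [|phi(u)| > d].  The Folner property then bounds
   [|e(u(y)) - 1|] by [sup_x |f(x + y) - f(x)| / d], up to a small error, for [y]
   in any prescribed finite set.  A limit of such [u] along an ultrafilter
   satisfies the bound for all [y], hence is continuous. *)

Set Implicit Arguments.
Unset Strict Implicit.
Unset Printing Implicit Defensive.

Import Order.TTheory GRing.Theory Num.Theory.
Import numFieldNormedType.Exports.

Local Open Scope ring_scope.

(** * Boxes and sumsets in abelian groups *)

Section sumsets.
Context (G : zmodType).
Implicit Types (l s b : seq G) (x y g : G).

(** Entries are listed with repetitions, so that an average over a box is an iterated average along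
    the generators. Duplicates are removed only where cardinalities matter. *)
Fixpoint box (N : nat) l : seq G :=
  if l is g :: l' then [seq g *+ j + x | j <- iota 0 N.+1, x <- box N l']
  else [:: 0].

Lemma size_box N l : size (box N l) = (N.+1 ^ size l)%N.
Proof.
elim: l => //= g l IHl.
rewrite (size_allpairs (fun j x => g *+ j + x) (0 :: iota 1 N)) /=.
by rewrite size_iota IHl expnS.
Qed.

Lemma box_consP N g l x :
  reflect (exists j y, [/\ (j <= N)%N, y \in box N l & x = g *+ j + y])
    (x \in box N (g :: l)).
Proof.
apply: (iffP allpairsP) => [[[j y] /= [jN yl ->]]|[j [y [jN yl ->]]]].
  by exists j, y; split=> //; rewrite (mem_iota 0 N.+1) in jN.
by exists (j, y); split=> //; rewrite (mem_iota 0 N.+1).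
Qed.

Lemma box_add N M l x y :
  x \in box N l -> y \in box M l -> x + y \in box (N + M) l.
Proof.
elim: l x y => [|g l IHl] x y.
  by rewrite !inE => /eqP-> /eqP->; rewrite addr0.
move=> /box_consP[i [x' [iN x'l ->]]] /box_consP[j [y' [jM y'l ->]]].
apply/box_consP; exists (i + j)%N, (x' + y'); rewrite leq_add// IHl//; split=> //.
by rewrite mulrnDr addrACA.
Qed.

Lemma box_0 N l : 0 \in box N l.
Proof.
elim: l => [|g l IHl]; first by rewrite inE.
by apply/box_consP; exists 0, 0; rewrite addr0.
Qed.

Lemma box_gen l g : g \in l -> g \in box 1 l.
Proof.
elim: l => // h l IHl; rewrite inE => /predU1P[->|gl]; apply/box_consP.
  by exists 1, 0; rewrite addr0 box_0.
by exists 0, g; rewrite add0r IHl.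
Qed.

(** Keeping repetitions makes the average of a character over [sumset a s] the [a]-th power of its
    average over [s]. *)
Fixpoint sumset (a : nat) s : seq G :=
  if a is a'.+1 then [seq x + y | x <- s, y <- sumset a' s] else [:: 0].

Lemma sumset_box a N l : {subset sumset a (box N l) <= box (a * N) l}.
Proof.
elim: a => [|a IHa] x /=; first by rewrite inE => /eqP->; exact: box_0.
by case/allpairsP=> -[y z] /= [yl /IHa zl ->]; rewrite mulSn box_add.
Qed.

Lemma size_sumset a s : size (sumset a s) = (size s ^ a)%N.
Proof. by elim: a => //= a IHa; rewrite (size_allpairs +%R) IHa expnS. Qed.

Lemma sqr_sum_le (I : Type) (r : seq I) (F : I -> nat) :
  ((\sum_(i <- r) F i) ^ 2 <= size r * \sum_(i <- r) F i ^ 2)%N.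
Proof.
rewrite -(leq_pmul2l (ltn0Sn 1)) -mulnn big_distrlr/= big_distrr/=.
apply: (@leq_trans (\sum_(i <- r) \sum_(j <- r) (F i ^ 2 + F j ^ 2))).
  apply: leq_sum => i _; rewrite big_distrr/=.
  by apply: leq_sum => j _; exact: nat_Cauchy.
rewrite mul2n -addnn; under eq_bigr do rewrite big_split/=.
rewrite big_split/= leq_add//.
  rewrite big_distrr/=; apply: leq_sum => i _.
  by rewrite big_const_seq count_predT iter_addn_0 mulnC.
by rewrite big_const_seq count_predT iter_addn_0 mulnC.
Qed.

(** Cauchy-Schwarz for multiplicities: the entries of [s] take at most [size b] values, and the
    double sum is the sum of the squared multiplicities. *)
Lemma coincidences_lower_bound s b : {subset s <= b} ->
  (size s ^ 2 <= size b * \sum_(x <- s) \sum_(y <- s) (x == y))%N.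
Proof.
move=> sb.
have cnt x : (\sum_(y <- s) (x == y) = count_mem x s)%N.
  rewrite -sum1_count [RHS]big_mkcond/=.
  by apply: eq_bigr => y _; rewrite eq_sym; case: eqP.
have sumE F : (\sum_(x <- s) F x = \sum_(x <- undup b) count_mem x s * F x)%N.
  transitivity (\sum_(x <- s) \sum_(y <- undup b) (x == y) * F y)%N.
    rewrite big_seq [RHS]big_seq; apply: eq_bigr => x xs.
    rewrite (bigD1_seq x) ?mem_undup ?undup_uniq ?sb//= eqxx mul1n.
    by rewrite big1 ?addn0// => y /negbTE; rewrite eq_sym => ->.
  rewrite exchange_big/=; apply: eq_bigr => x _; rewrite -big_distrl/= -cnt.
  by congr (_ * _)%N; apply: eq_bigr => y _; rewrite eq_sym.
have -> : size s = (\sum_(x <- undup b) count_mem x s)%N.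
  rewrite -sum1_size sumE; by apply: eq_bigr => x _; rewrite muln1.
apply: leq_trans (sqr_sum_le _ _) _.
rewrite leq_mul ?size_undup// sumE; apply: leq_sum => x _.
by rewrite cnt mulnn.
Qed.

Lemma exp2_beats_poly k : exists n, ((2 * n).+1 ^ k < 2 ^ n)%N.
Proof.
(* Once the base is bounded by [4 ^ m.+1], comparing exponents of [2] leaves [m * m.+1 < 4 ^ m]. *)
pose m := (2 * k)%N; exists (4 ^ m)%N.
have mlt : (m < 2 ^ m)%N by exact: ltn_expl.
have le1 : ((2 * 4 ^ m).+1 <= 4 ^ m.+1)%N.
  rewrite expnS -[X in (_ <= X)%N]/((2 + 2) * 4 ^ m)%N mulnDl -addn1 leq_add2l.
  by rewrite muln_gt0 expn_gt0.
apply: (@leq_ltn_trans ((4 ^ m.+1) ^ k)).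
  by case: (k) => // k'; rewrite leq_exp2r.
rewrite -expnM -[4%N]/(2 ^ 2)%N -!expnM ltn_exp2l//.
rewrite mulnCA -/m [X in (_ < 2 ^ X)%N]mul2n -addnn expnD mulnC.
apply: (@leq_ltn_trans (m * 2 ^ m)%N); first by rewrite leq_mul2l mlt orbT.
by rewrite ltn_pmul2r ?expn_gt0.
Qed.

(* The number of elements of [box n l] is polynomially bounded in [n]. *)
Lemma box_growth l :
  exists n, (size (undup (box n.+2 l)) <= 2 * size (undup (box n l)))%N.
Proof.
have [k] := exp2_beats_poly (size l); rewrite ltnNge => /negP kP.
pose sz n := size (undup (box n l)).
(* If every step from [2 * n] to [2 * n + 2] with [n < k] failed, the size would more than double
   [k] times and reach [2 ^ k], beyond the [(2 * k).+1 ^ size l] entries of the box. *)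
have [//|noP] := boolP [exists n : 'I_k, (sz (2 * n).+2 <= 2 * sz (2 * n))%N].
  by case/existsP => n nP; exists (2 * n)%N.
case: kP; rewrite -(size_box (2 * k) l).
apply: (@leq_trans (sz (2 * k)%N)); last exact: size_undup.
have {noP} lt2 n : (n < k)%N -> (2 * sz (2 * n) < sz (2 * n).+2)%N.
  move=> nk; rewrite ltnNge; apply/negP => le2.
  by case/existsP: noP; exists (Ordinal nk).
elim: k lt2 => [|k IHk] lt2.
  rewrite lt0n size_eq0; apply/eqP => /(congr1 (fun s => 0 \in s)).
  by rewrite mem_undup box_0.
rewrite mulnS; apply: leq_trans _ (ltnW (lt2 _ (ltnSn k))); rewrite expnS leq_mul2l/=.
by apply: IHk => n nk; apply: lt2; rewrite ltnW.
Qed.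

End sumsets.

Section morphisms.
Context (G T : zmodType) (u : G -> T) (uD : {morph u : x y / x + y}).

Lemma morph_add0 : u 0 = 0.
Proof. by apply: (addrI (u 0)); rewrite -uD !addr0. Qed.

Lemma morph_addN x : u (- x) = - u x.
Proof. by apply: (addrI (u x)); rewrite -uD !subrr morph_add0. Qed.

Lemma morph_addB x y : u (x - y) = u x - u y.
Proof. by rewrite uD morph_addN. Qed.

End morphisms.

(** * Averages over boxes and their near invariance under translation *)

Section averages.
Context (G : zmodType) (C : numFieldType).
Implicit Types (l s : seq G) (F : G -> C).

Definition avg s F : C := (\sum_(x <- s) F x) / (size s)%:R.

Lemma eq_avg s F1 F2 : F1 =1 F2 -> avg s F1 = avg s F2.
Proof. by move=> F12; congr (_ / _); apply: eq_bigr => x _. Qed.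

Lemma avgB s F1 F2 : avg s F1 - avg s F2 = avg s (fun x => F1 x - F2 x).
Proof. by rewrite /avg sumrB mulrBl. Qed.

Lemma avgMl s a F : avg s (fun x => a * F x) = a * avg s F.
Proof. by rewrite /avg -mulr_sumr mulrA. Qed.

Lemma avgMr s a F : avg s (fun x => F x * a) = avg s F * a.
Proof. by rewrite /avg -mulr_suml mulrAC. Qed.

Lemma avg_cons s a : s != [::] -> avg s (fun=> a) = a.
Proof.
move=> s0; rewrite /avg big_const_seq count_predT iter_addr_0 -(mulr_natr a) mulfK//.
by rewrite pnatr_eq0 size_eq0.
Qed.

Lemma avg_ge0 s F : (forall x, 0 <= F x) -> 0 <= avg s F.
Proof. by move=> F0; rewrite mulr_ge0 ?invr_ge0 ?ler0n// sumr_ge0. Qed.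

Lemma ler_norm_avg s F a : 0 <= a -> (forall x, `|F x| <= a) -> `|avg s F| <= a.
Proof.
move=> a0 Fa; have [->|s0] := eqVneq s [::].
  by rewrite /avg big_nil mul0r normr0.
rewrite -[leRHS](avg_cons a s0) /avg normrM normfV normr_nat.
by rewrite ler_wpM2r ?invr_ge0 ?ler0n// (le_trans (ler_norm_sum _ _ _))// ler_sum.
Qed.

Lemma avg_box_cons N g l F :
  avg (box N (g :: l)) F =
  (\sum_(0 <= j < N.+1) avg (box N l) (fun x => F (g *+ j + x))) / N.+1%:R.
Proof.
have -> : avg (box N (g :: l)) F = (\sum_(j <- iota 0 N.+1)
    \sum_(x <- box N l) F (g *+ j + x)) / (size (box N (g :: l)))%:R.
  congr (_ / _); exact: (@big_allpairs_dep _ _ _ nat (fun=> G) G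
    (fun j x => g *+ j + x) (iota 0 N.+1) (fun=> box N l) F).

rewrite size_box expnS natrM invfM mulrA mulrAC; congr (_ / _).
rewrite mulr_suml /index_iota subn0; apply: eq_bigr => j _.
by rewrite /avg size_box.
Qed.

(** The Folner property. Along the direction of [g] the difference telescopes, leaving two of the
    layer averages, each at most [1] in norm, divided by [N.+1]; the other directions are handled by
    averaging the induction hypothesis. *)
Lemma avg_box_shift N l g F : g \in l -> (forall x, `|F x| <= 1) ->
  `|avg (box N l) (fun x => F (x + g)) - avg (box N l) F| <= 2 / N.+1%:R.
Proof.
elim: l F => // h l IHl F; rewrite inE !avg_box_cons -mulrBl -sumrB => gl F1.
have [gl'|gl'] := boolP (g \in l).
  rewrite normrM normfV normr_nat ler_wpM2r ?invr_ge0 ?ler0n//.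
  apply: le_trans (ler_norm_sum _ _ _) _.
  have -> : 2 = \sum_(0 <= j < N.+1) 2 / N.+1%:R :> C.
    by rewrite sumr_const_nat subn0 -(mulr_natr (2 / _)) divfK ?pnatr_eq0.
  rewrite ler_sum// => j _.
  apply: le_trans (IHl (fun x => F (h *+ j + x)) gl' _); last by [].
  by under eq_avg do rewrite -addrA.
move: gl; rewrite (negbTE gl') orbF => /eqP->.
set A := fun j => avg (box N l) (fun x => F (h *+ j + x)).
have AS j : avg (box N l) (fun x => F (h *+ j + x + h)) = A j.+1.
  by apply: eq_avg => x; rewrite mulrSr addrAC.
under eq_bigr do rewrite AS.
rewrite telescope_sumr// normrM normfV normr_nat ler_wpM2r ?invr_ge0 ?ler0n//.
apply: le_trans (ler_normB _ _) _; rewrite -[2]/(1 + 1) lerD//;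
  by apply: ler_norm_avg => // x.
Qed.

Lemma avg_sumset s a (phi : G -> C) :
  {morph phi : x y / x + y >-> x * y} -> phi 0 = 1 ->
  avg (sumset a s) phi = avg s phi ^+ a.
Proof.
move=> phiD phi0; elim: a => [|a IHa].
  by rewrite /avg/= big_seq1 phi0 divr1.
rewrite exprS -IHa /avg/= big_allpairs_dep (size_allpairs +%R) natrM invfM.
rewrite mulrACA; congr (_ * _); rewrite mulr_suml; apply: eq_bigr => x _.
by rewrite mulr_sumr; apply: eq_bigr => y _.
Qed.

End averages.

(** * Trigonometric polynomials on the dual of a discrete group *)

Section energy.
Context (G : zmodType) (C : numFieldType).
Implicit Types (s t : seq G) (F : G -> C).

Lemma ler_sum_map (I J : eqType) (s : seq I) (t : seq J) (h : I -> J) (F : J -> C) :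
  uniq s -> injective h -> (forall x, x \in s -> h x \in t) -> (forall x, 0 <= F x) ->
  \sum_(x <- s) F (h x) <= \sum_(x <- t) F x.
Proof.
move=> us injh sth F0; rewrite -(big_map h predT F).
have : uniq (map h s) by rewrite map_inj_uniq.
have : {subset map h s <= t} by move=> _ /mapP[x /sth + ->].
move: (map h s) => {h injh sth us s} s; elim: s t => [|x s IHs] t st /=.
  by rewrite big_nil sumr_ge0.
case/andP=> xs us; rewrite big_cons (perm_big _ (perm_to_rem (st x (mem_head _ _)))).
rewrite big_cons lerD2l IHs// => y ys; have := st y; rewrite inE ys orbT => /(_ isT).
rewrite (perm_mem (perm_to_rem (st x (mem_head _ _)))) inE => /predU1P[yx|//].
by rewrite -yx ys in xs.
Qed.

Context (f : G -> C) (V : pred G).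
Context (f0 : forall x, 0 <= f x).
Context (fV : forall x z, V x -> V z -> 2^-1 <= f (x + z)).
Context (V0 : V 0).

(* The coefficient at [0] of [|sum_(x <- s) f x e(u x)|^2 |sum_(z <- t) f z e(u z)|^2]
   as a trigonometric polynomial in [u]. *)
Definition energy s t : C := \sum_(x <- s) \sum_(x' <- s) \sum_(z <- t) \sum_(z' <- t)
  f x * f x' * (f z * f z') * (x - x' + (z - z') == 0)%:R.

(* Keeps only the terms with [z = w + x'], [z' = w + x] for some [w] in [t1]. *)
Lemma energy_ge_squares s t1 t2 : uniq t1 -> uniq t2 ->
  (forall w x, w \in t1 -> x \in s -> w + x \in t2) ->
  \sum_(w <- t1) (\sum_(x <- s) f x * f (w + x)) ^+ 2 <= energy s t2.
Proof.
move=> u1 u2 t12.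
under eq_bigr do rewrite expr2 big_distrlr/=.
rewrite exchange_big/= /energy big_seq [leRHS]big_seq ler_sum// => x xs.
rewrite exchange_big/= big_seq [leRHS]big_seq ler_sum// => x' x's.
apply: le_trans (_ : \sum_(w <- t1) (\sum_(z' <- t2)
    f x * f x' * (f (w + x') * f z') * (x - x' + (w + x' - z') == 0)%:R) <= _).
  rewrite big_seq [leRHS]big_seq ler_sum// => w wt1.
  rewrite (bigD1_seq (w + x))//= ?t12// -[leLHS]addr0 lerD//; last first.
    by rewrite sumr_ge0// => z' _; rewrite !mulr_ge0.
  have -> : x - x' + (w + x' - (w + x)) = 0.
    by rewrite opprD [w + x' + _]addrACA subrr add0r -(opprB x x') subrr.
  by rewrite eqxx mulr1 [f (w + x') * _]mulrC mulrACA.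
apply: (@ler_sum_map _ _ _ _ (fun w => w + x') (fun z => \sum_(z' <- t2)
    f x * f x' * (f z * f z') * (x - x' + (z - z') == 0)%:R)) => //.
- exact: addIr.
- by move=> w wt1; rewrite t12.
- by move=> z; rewrite sumr_ge0// => z' _; rewrite !mulr_ge0.
Qed.

(** For [w] in [V], every [x] in [V] adds at least [1/4] to the inner sum of [energy_ge_squares]; so
    the energy is at least [(A / 4) ^+ 2] times the number of points of [t1] in [V]. The covering by
    [c] bounds [size t2] by [2 * size c] times that number, and the constant is [16 * 4 * 2]. *)
Lemma energy_lower_bound (c s t0 t1 t2 : seq G) :
  uniq t0 -> uniq t1 -> uniq t2 ->
  (forall w x, w \in t1 -> x \in s -> w + x \in t2) ->
  (forall w i, w \in t0 -> i \in c -> w - i \in t1) ->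
  (forall x, exists2 i, i \in c & V (x - i)) ->
  (size t2 <= 2 * size t0)%N ->
  (size s)%:R <= (2 * size c)%:R * \sum_(x <- s) (V x)%:R :> C ->
  (size s ^ 2 * size t2)%:R <= (128 * size c ^ 3)%:R * energy s t2.
Proof.
move=> u0 u1 u2 t12 t01 cov st sV.
set A := \sum_(x <- s) (V x)%:R in sV.
have A0 : 0 <= A by rewrite sumr_ge0.
have sqV w : (V w)%:R * (A / 4) ^+ 2 <= (\sum_(x <- s) f x * f (w + x)) ^+ 2.
  have [Vw|_] := boolP (V w); last first.
    by rewrite mul0r exprn_ge0// sumr_ge0// => x _; rewrite mulr_ge0.
  rewrite mul1r lerXn2r ?nnegrE ?sumr_ge0 ?divr_ge0//.
    by move=> x _; rewrite mulr_ge0.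
  rewrite mulr_suml ler_sum// => x _.
  have [Vx|_] := boolP (V x); last by rewrite mul0r mulr_ge0.
  have -> : 1 / 4 = 2^-1 * 2^-1 :> C by field.
  by rewrite ler_pM ?invr_ge0 ?ler0n// ?fV// -[x]addr0 fV.
have t0V : (size t0)%:R <= (size c)%:R * \sum_(w <- t1) (V w)%:R :> C.
  apply: (@le_trans _ _ (\sum_(i <- c) \sum_(w <- t0) (V (w - i))%:R)).
    rewrite exchange_big/= -sum1_size natr_sum big_seq [leRHS]big_seq ler_sum// => w wt0.
    have [i ic Vi] := cov w.
    rewrite (big_rem i)//= Vi lerDl sumr_ge0//.
  rewrite mulr_natl -[X in _ *+ X]count_predT -iter_addr_0 -big_const_seq.
  rewrite big_seq [leRHS]big_seq ler_sum// => i ic.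
  apply: (@ler_sum_map _ _ _ _ (fun w => w - i) (fun w => (V w)%:R)) => //.
  - exact: addIr.
  - by move=> w wt0; rewrite t01.
have := energy_ge_squares u1 u2 t12.
have : (\sum_(w <- t1) (V w)%:R) * (A / 4) ^+ 2 <=
    \sum_(w <- t1) (\sum_(x <- s) f x * f (w + x)) ^+ 2.
  by rewrite mulr_suml ler_sum.
move=> /le_trans /[apply]; set N1 := \sum_(w <- t1) _ in t0V *.
set W := energy s t2 => N1W.
have N10 : 0 <= N1 by rewrite sumr_ge0.
have c0 : 0 <= (size c)%:R :> C by [].
have st' : (size t2)%:R <= 2 * (size c)%:R * N1.
  by rewrite -mulrA (le_trans (_ : _ <= (2 * size t0)%:R)) ?ler_nat// natrM ler_wpM2l.
have sV2 : (size s)%:R ^+ 2 <= ((2 * size c)%:R * A) ^+ 2.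
  by rewrite lerXn2r ?nnegrE ?mulr_ge0.
rewrite natrM natrX; apply: le_trans (ler_pM (exprn_ge0 2 _) _ sV2 st') _ => //.
rewrite [leLHS](_ : _ = (128 * size c ^ 3)%:R * (N1 * (A / 4) ^+ 2)).
  by rewrite ler_wpM2l.
by rewrite natrM [in RHS]natrM natrX; field.
Qed.

End energy.

Section trigonometric_polynomials.
Context (G T : zmodType) (C : numClosedFieldType) (e : T -> C).
Context (eD : {morph e : s t / s + t >-> s * t}).
Context (norm_e : forall t, `|e t| = 1).
Context (e_eq1 : forall t, e t = 1 -> t = 0).

Lemma e_0 : e 0 = 1.
Proof.
have e0 : e 0 != 0 by rewrite -normr_gt0 norm_e.
by apply: (mulfI e0); rewrite -eD addr0 mulr1.
Qed.

Lemma e_N t : e (- t) = (e t)^*.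
Proof.
have e0 : e t != 0 by rewrite -normr_gt0 norm_e.
by apply: (mulfI e0); rewrite -eD subrr e_0 -normCK norm_e expr1n.
Qed.

Lemma e_Mn t n : e (t *+ n) = e t ^+ n.
Proof. by elim: n => [|n IHn]; rewrite ?mulr0n ?e_0// mulrS exprS eD IHn. Qed.

Context (separation : forall y : G, y != 0 -> exists v : G -> T,
  [/\ {morph v : x y / x + y}, v y != 0 & exists2 n, (0 < n)%N & v y *+ n = 0]).

(** For each new [y != 0], the family is multiplied by the multiples [w *+ i], [i < n], of a
    homomorphism with [w y] nonzero and killed by [n]. The sums factor: those already zero stay
    zero, and at [y] a geometric sum over a nontrivial root of unity vanishes. *)
Lemma orthogonal_family (s : seq G) :
  exists (I : finType) (v : I -> G -> T),
  [/\ (0 < #|I|)%N, forall i, {morph v i : x y / x + y} &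
    forall y, y \in s -> \sum_i e (v i y) = (y == 0)%:R * #|I|%:R].
Proof.
elim: s => [|y s [I [v [I0 vD sv]]]].
  exists unit, (fun _ _ => 0); split=> [|_ x z|//]; rewrite ?card_unit//.
  by rewrite addr0.
have [->|y0] := eqVneq y 0.
  exists I, v; split=> // z; rewrite inE => /predU1P[->|/sv//].
  rewrite eqxx mul1r (eq_bigr (fun=> 1)) ?sumr_const// => i _.
  by rewrite (morph_add0 (vD i)) e_0.
have [w [wD wy0 [n n0 wyn]]] := separation y0.
exists ('I_n * I)%type, (fun (p : 'I_n * I) x => w x *+ p.1 + v p.2 x); split.
- by rewrite card_prod card_ord muln_gt0 n0.
- by move=> p x z /=; rewrite wD vD mulrnDl addrACA.
move=> z zs; rewrite -(pair_bigA _ (fun (i : 'I_n) j => e (w z *+ i + v j z)))/=.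
have -> : \sum_(i < n) \sum_j e (w z *+ i + v j z) =
    (\sum_(i < n) e (w z) ^+ i) * \sum_j e (v j z).
  rewrite mulr_suml; apply: eq_bigr => i _; rewrite mulr_sumr.
  by apply: eq_bigr => j _; rewrite eD e_Mn.
rewrite card_prod card_ord natrM.
have [z0|z0] := eqVneq z 0.
  rewrite z0 (morph_add0 wD) e_0 mul1r; congr (_ * _).
    by under eq_bigr do rewrite expr1n; rewrite sumr_const card_ord.
  rewrite (eq_bigr (fun=> 1)) ?sumr_const// => i _.
  by rewrite (morph_add0 (vD i)) e_0.
rewrite mul0r; move: zs; rewrite inE => /predU1P[zy|/sv ->]; last first.
  by rewrite (negbTE z0) mul0r mulr0.
rewrite zy; apply/eqP; rewrite mulf_eq0; apply/orP; left.
have : (e (w y) - 1) * \sum_(i < n) e (w y) ^+ i == 0.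
  by rewrite -subrX1 -e_Mn wyn e_0 subrr.
by rewrite mulf_eq0 subr_eq0 => /predU1P[/e_eq1/eqP|//]; rewrite (negbTE wy0).
Qed.

Implicit Types (p q : seq (C * G)) (u : G -> T).

(* A trigonometric polynomial [sum_a c_a e(u y_a)] in the homomorphism [u] is
   given by the list of the pairs [(c_a, y_a)]; [mean] is its coefficient at [0]. *)
Definition trig p u : C := \sum_(a <- p) a.1 * e (u a.2).

Definition mean p : C := \sum_(a <- p) a.1 * (a.2 == 0)%:R.

Definition trig_mul p q := [seq (a.1 * b.1, a.2 + b.2) | a <- p, b <- q].

Definition trig_scale k p := [seq (k * a.1, a.2) | a <- p].

Definition trig_quad (s : seq G) (w : G -> G -> C) :=
  [seq (w x y, x - y) | x <- s, y <- s].

Lemma trigM p q u : {morph u : x y / x + y} ->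
  trig (trig_mul p q) u = trig p u * trig q u.
Proof.
move=> uD; rewrite /trig big_allpairs_dep/=.
rewrite big_distrlr/=; apply: eq_bigr => a _; apply: eq_bigr => b _.
by rewrite uD eD mulrACA.
Qed.

Lemma trigZ k p u : trig (trig_scale k p) u = k * trig p u.
Proof. by rewrite /trig big_map mulr_sumr; apply: eq_bigr => a _; rewrite mulrA. Qed.

Lemma trig_cat p q u : trig (p ++ q) u = trig p u + trig q u.
Proof. exact: big_cat. Qed.

Lemma mean_cat p q : mean (p ++ q) = mean p + mean q.
Proof. exact: big_cat. Qed.

Lemma meanZ k p : mean (trig_scale k p) = k * mean p.
Proof. by rewrite /mean big_map mulr_sumr; apply: eq_bigr => a _; rewrite mulrA. Qed.

Lemma trig_quadE s w u : {morph u : x y / x + y} ->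
  trig (trig_quad s w) u = \sum_(x <- s) \sum_(y <- s) w x y * (e (u x) * (e (u y))^*).
Proof.
move=> uD; rewrite /trig big_allpairs_dep/=.
by apply: eq_bigr => x _; apply: eq_bigr => y _; rewrite (morph_addB uD) eD e_N.
Qed.

(** The average of [trig p] over an orthogonal family for the frequencies of [p] is [mean p], so its
    values there cannot all be nonpositive. Realness makes them comparable with [0] in the partial
    order of [C]. *)
Lemma exists_trig_gt0 p : (forall u, {morph u : x y / x + y} -> trig p u \is Num.real) ->
  0 < mean p -> exists2 u, {morph u : x y / x + y} & 0 < trig p u.
Proof.
move=> preal mp; have [I [v [I0 vD sv]]] := orthogonal_family (map snd p).
have [/existsP[i vi]|/existsPn noi] := boolP [exists i, 0 < trig p (v i)].
  by exists (v i).
have : \sum_i trig p (v i) = mean p * #|I|%:R.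
  rewrite exchange_big/= mulr_suml big_seq [RHS]big_seq; apply: eq_bigr => a ap.
  by rewrite -mulr_sumr sv ?mulrA// map_f.
move/eqP; rewrite lt_eqF// (@le_lt_trans _ _ 0) ?mulr_gt0 ?ltr0n// sumr_le0// => i _.
by rewrite real_leNgt ?preal ?real0// noi.
Qed.

End trigonometric_polynomials.

(** * Approximation of a character on finitely many points *)

Section kernel.
Context (G : zmodType) (C : numFieldType).

(* The kernel is [|avg (box N l) psi|^(2a)], with [psi] the character
   [e(u - chi)].  If it is at least [s], then [|psi g - 1|] is at most
   [2 / (N s^(1/2a))] for [g] in [l].  As the [a]-th power of the average involves
   at most [(aN + 1)^k] elements, [k = size l], the coefficient at [0] is at least
   [(aN + 1)^-k]; hence taking [a > k] makes [s] about [N^-k] affordable. *)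
Definition kernel_exp (l : seq G) := (size l).+1.

Definition kernel_width (J : nat) (l : seq G) := (8 * J ^ 2 * kernel_exp l)%N.

Definition kernel_support (J : nat) (l : seq G) : seq G :=
  sumset (kernel_exp l) (box (kernel_width J l) l).

Definition kernel_bound (J : nat) (l : seq G) :=
  ((kernel_exp l * kernel_width J l).+1 ^ size l)%N.

(** Since [size l < a], the factor [2 * kernel_bound J l] is at most [(2 * a * N.+1) ^ a]; it
    remains that [8 * J ^ 2 * a <= N.+1], which dictates [kernel_width]. *)
Lemma kernel_boundP J l : (0 < J)%N ->
  ((4 * J ^ 2) ^ kernel_exp l * (2 * kernel_bound J l) <=
   (kernel_width J l).+1 ^ (2 * kernel_exp l))%N.
Proof.
move=> J0; rewrite /kernel_bound; set a := kernel_exp l; set N := kernel_width J l.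
have le1 : ((a * N).+1 ^ size l <= (a * N.+1) ^ a)%N.
  apply: (@leq_trans ((a * N.+1) ^ size l)).
    by case: (size l) => // k; rewrite leq_exp2r// mulnS -add1n leq_add2r.
  by rewrite leq_pexp2l.
apply: (@leq_trans ((4 * J ^ 2) ^ a * (2 ^ a * (a * N.+1) ^ a))).
  rewrite leq_mul2l leq_mul ?orbT//.
  by rewrite -[X in (X <= _)%N]expn1 leq_pexp2l.
rewrite -!expnMn expnM leq_exp2r// expnS expn1 !mulnA leq_mul2r/=.
by rewrite leqW// /N /kernel_width -/a expnS expn1 [(_ * 2)%N]mulnC !mulnA.
Qed.

(** Translating by [g] multiplies the average of [psi] by [psi g], so the Folner bound gives
    [|psi g - 1| * P <= 2 / N.+1]. A deviation above [1 / J] would make [P] too small by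
    [kernel_boundP]. *)
Lemma kernel_concentration (psi : G -> C) J l g : (0 < J)%N ->
  {morph psi : x y / x + y >-> x * y} -> (forall x, `|psi x| = 1) ->
  1 < (2 * kernel_bound J l)%:R *
      `|avg (box (kernel_width J l) l) psi| ^+ (2 * kernel_exp l) ->
  g \in l -> `|psi g - 1| <= J%:R^-1.
Proof.
move=> J0 psiD psi1; set P := `|_|; set m := kernel_bound J l.
set a := kernel_exp l; set N := kernel_width J l => mP gl.
have J0' : 0 < J%:R :> C by rewrite ltr0n.
rewrite real_leNgt ?realE ?normr_ge0 ?invr_ge0 ?ler0n//; apply/negP => Jpsi.
have shift : `|psi g - 1| * P <= 2 / N.+1%:R.
  rewrite /P -normrM mulrBl mul1r [psi g * _]mulrC -avgMr.
  rewrite (eq_avg _ (fun x => esym (psiD x g))).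
  by apply: avg_box_shift => // x; rewrite psi1.
have {shift} P2 : P <= (2 * J)%:R / N.+1%:R.
  rewrite natrM mulrAC -ler_pdivrMr// mulrC (le_trans _ shift)//.
  by rewrite ler_wpM2r ?normr_ge0// ltW.
have : P ^+ (2 * a) <= ((2 * J)%:R / N.+1%:R) ^+ (2 * a).
  by rewrite lerXn2r ?nnegrE ?normr_ge0 ?divr_ge0//.
rewrite -(@ler_pM2l _ (2 * m)%:R) => [/(lt_le_trans mP)|]; last first.
  by rewrite ltr0n muln_gt0 expn_gt0.
rewrite expr_div_n mulrA ltr_pdivlMr ?exprn_gt0 ?ltr0n// mul1r -!natrX -natrM ltr_nat.
apply/negP; rewrite -leqNgt expnM expnMn mulnC; exact: kernel_boundP.
Qed.

End kernel.

(** * Density of a covering set in a box, and sets of small doubling *)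

Section cover.
Context (G : zmodType) (C : numFieldType).

Lemma avg_box_cover (V : pred G) (c l : seq G) N :
  (forall x, exists2 i, i \in c & V (x - i)) -> {subset c <= l} ->
  (4 * size c <= N)%N ->
  (size (box N l))%:R <= (2 * size c)%:R * \sum_(x <- box N l) (V x)%:R :> C.
Proof.
move=> cov cl cN; set s := box N l.
have s0 : s != [::] by rewrite -size_eq0 size_box expn_eq0.
have sz0 : 0 < (size s)%:R :> C by rewrite ltr0n lt0n size_eq0.
set ind : G -> C := fun x => (V x)%:R.
have A0 : 0 <= avg s ind by rewrite avg_ge0// => x; rewrite ler0n.
have shift i : i \in c -> avg s (fun x => ind (x - i)) <= avg s ind + 2 / N.+1%:R.
  move=> /cl il; rewrite addrC -lerBlDr.
  apply: le_trans (_ : `|avg s (fun x => ind (x - i)) - avg s ind| <= _).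
    by rewrite real_ler_norm// rpredB// ger0_real// avg_ge0// => x; rewrite ler0n.
  rewrite distrC; have := @avg_box_shift _ _ N _ _ (fun x => ind (x - i)) il.
  under eq_avg do rewrite addrK.
  by apply=> x; rewrite /ind normr_nat; case: (V _); rewrite ?lexx ?ler01.
have le1 : 1 <= (size c)%:R * (avg s ind + 2 / N.+1%:R).
  apply: (@le_trans _ _ (\sum_(i <- c) avg s (fun x => ind (x - i)))).
    rewrite -(avg_cons 1 s0) /avg -mulr_suml exchange_big/= ler_wpM2r ?invr_ge0//.
    rewrite ler_sum// => x _; have [i ic Vi] := cov x.
    by rewrite (big_rem i)//= /ind Vi lerDl sumr_ge0// => j _; rewrite ler0n.
  rewrite mulr_natl -[X in _ *+ X]count_predT -iter_addr_0 -big_const_seq.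
  by rewrite big_seq [leRHS]big_seq ler_sum// => i /shift.
have le2 : (size c)%:R * (2 / N.+1%:R) <= 2^-1 :> C.
  rewrite mulrA ler_pdivrMr ?ltr0n// [leRHS]mulrC ler_pdivlMr ?ltr0n// -!natrM ler_nat.
  by rewrite -mulnA mulnC leqW.
have : 1 - 2^-1 <= (size c)%:R * avg s ind.
  by rewrite lerBlDr (le_trans le1)// mulrDr lerD2l.
rewrite /avg mulrA ler_pdivlMr// -(ler_pM2l (ltr0n C 2)).
rewrite (_ : 2 * _ = (size s)%:R); last by field.
by rewrite natrM mulrA.
Qed.

(** Boxes of widths [n], [n.+1], [n.+2] on the generators [s] and [- c], with [n] given by
    polynomial growth. *)
Lemma exists_nested_boxes (s c : seq G) : exists t0 t1 t2 : seq G,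
  [/\ [/\ uniq t0, uniq t1, uniq t2 & 0 \in t2],
    forall w x, w \in t1 -> x \in s -> w + x \in t2,
    forall w i, w \in t0 -> i \in c -> w - i \in t1 &
    (size t2 <= 2 * size t0)%N].
Proof.
pose gens := s ++ map -%R c; have [n szn] := box_growth gens.
have step m w x : w \in box m gens -> x \in gens -> w + x \in box m.+1 gens.
  by move=> wm xg; rewrite -addn1 box_add// box_gen.
exists (undup (box n gens)), (undup (box n.+1 gens)), (undup (box n.+2 gens)).
split=> //; first by rewrite !undup_uniq mem_undup box_0.
- by move=> w x; rewrite !mem_undup => wt xs; rewrite step// mem_cat xs.
- by move=> w i; rewrite !mem_undup => wt ic; rewrite step// mem_cat map_f ?orbT.
Qed.

End cover.

(** * A positive mean and the homomorphism it yields *)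

Section approximation.
Context (G T : zmodType) (C : numClosedFieldType) (e : T -> C).
Context (eD : {morph e : s t / s + t >-> s * t}).
Context (norm_e : forall t, `|e t| = 1).
Context (e_eq1 : forall t, e t = 1 -> t = 0).
Context (separation : forall y : G, y != 0 -> exists v : G -> T,
  [/\ {morph v : x y / x + y}, v y != 0 & exists2 n, (0 < n)%N & v y *+ n = 0]).

Lemma mean_mul2 (p q : seq (C * G)) : mean (trig_mul p q) =
  \sum_(a <- p) \sum_(b <- q) a.1 * b.1 * (a.2 + b.2 == 0)%:R.
Proof. by rewrite /mean big_allpairs_dep. Qed.

Lemma mean_mul3 (p q r : seq (C * G)) : mean (trig_mul (trig_mul p q) r) =
  \sum_(a <- p) \sum_(b <- q) \sum_(d <- r)
    a.1 * b.1 * d.1 * (a.2 + b.2 + d.2 == 0)%:R.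
Proof. by rewrite mean_mul2 big_allpairs_dep. Qed.

Lemma trig_quad_prod (s : seq G) (w : G -> C) (u : G -> T) :
  {morph u : x y / x + y} ->
  trig e (trig_quad s (fun x y => w x * (w y)^*)) u =
  `|\sum_(x <- s) w x * e (u x)| ^+ 2.
Proof.
move=> uD; rewrite (trig_quadE eD)// normCK rmorph_sum big_distrlr/=.
apply: eq_bigr => x _; apply: eq_bigr => y _.
by rewrite rmorphM mulrACA.
Qed.

Context (chi : G -> T) (chiD : {morph chi : x y / x + y}).
Context (l : seq G) (J : nat) (J0 : (0 < J)%N).
Context (f : G -> C) (V : pred G) (c : seq G).
Context (f0 : forall x, 0 <= f x).
Context (f1 : forall x, f x <= 1).
Context (fV : forall x z, V x -> V z -> 2^-1 <= f (x + z)).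
Context (V0 : V 0).
Context (cov : forall x, exists2 i, i \in c & V (x - i)).
Context (supp_f : forall t t', t \in kernel_support J l -> t' \in kernel_support J l ->
  forall x x' z z', f x != 0 -> f x' != 0 -> f z != 0 -> f z' != 0 ->
  t - t' + (x - x') + (z - z') = 0 -> t = t').

Let Q := kernel_support J l.
Let m := kernel_bound J l.
(** As a function of [u] this is [|sum_(x <- Q) e(u x - chi x)|^2], the kernel before
    normalisation. *)
Let K := trig_quad Q (fun x y => e (- chi x) * (e (- chi y))^*).

(** [D ^ 2] has to exceed [2 * m] times the constant [128 * size c ^ 3] of [energy_lower_bound]. The
    value is independent of [E] and [n] below, which the later passage to the limit requires. *)
Definition approximation_constant := (256 * m * size c ^ 3).+1.

Let D := approximation_constant.

Lemma mean_quad_f (s : seq G) : uniq s ->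
  mean (trig_quad s (fun x y => f x * f y)) <= (size s)%:R.
Proof.
move=> us; rewrite /mean big_allpairs_dep/= -sum1_size natr_sum.
rewrite big_seq [leRHS]big_seq ler_sum// => x xs.
rewrite (bigD1_seq x)//= subrr eqxx mulr1 big1 ?addr0 => [|y yx].
  by rewrite mulr_ile1.
by rewrite subr_eq0 eq_sym (negbTE yx) mulr0.
Qed.

Lemma mean_energy (s t : seq G) :
  mean (trig_mul (trig_quad s (fun x y => f x * f y))
    (trig_quad t (fun x y => f x * f y)))
  = energy f s t.
Proof.
rewrite mean_mul2 big_allpairs_dep; apply: eq_bigr => x _; apply: eq_bigr => x' _.
by rewrite big_allpairs_dep.
Qed.

(** By [supp_f] the support of [f] is too small for a term with [k != k'] to have frequency [0] and
    nonzero weight; for [k = k'] the phases cancel. *)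
Lemma mean_kernel_energy (s t : seq G) :
  mean (trig_mul (trig_mul K (trig_quad s (fun x y => f x * f y)))
    (trig_quad t (fun x y => f x * f y)))
  = (\sum_(x <- Q) \sum_(y <- Q) (x == y))%:R * energy f s t.
Proof.
rewrite mean_mul3 big_allpairs_dep natr_sum mulr_suml big_seq [RHS]big_seq.
apply: eq_bigr => k kQ; rewrite natr_sum mulr_suml big_seq [RHS]big_seq.
apply: eq_bigr => k' k'Q; rewrite big_allpairs_dep/= mulr_sumr.
apply: eq_bigr => x _; rewrite mulr_sumr; apply: eq_bigr => x' _.
rewrite big_allpairs_dep/= mulr_sumr; apply: eq_bigr => z _; rewrite mulr_sumr.
apply: eq_bigr => z' _.
have [->|kk'] := eqVneq k k'.
  by rewrite -normCK norm_e expr1n subrr add0r !mul1r.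
rewrite mul0r; have [/eqP kx|_] := boolP (_ == 0); last by rewrite mulr0.
apply/eqP; rewrite mulr1 mulf_eq0; apply/orP.
have [->|fx] := eqVneq (f x) 0; first by left; rewrite mul0r mulr0.
have [->|fx'] := eqVneq (f x') 0; first by left; rewrite !mulr0.
have [->|fz] := eqVneq (f z) 0; first by right; rewrite mul0r.
have [->|fz'] := eqVneq (f z') 0; first by right; rewrite mulr0.
by rewrite (supp_f kQ k'Q fx fx' fz fz' kx) eqxx in kk'.
Qed.

Lemma trig_quad_f (s : seq G) (u : G -> T) : {morph u : x y / x + y} ->
  trig e (trig_quad s (fun x y => f x * f y)) u = `|\sum_(x <- s) f x * e (u x)| ^+ 2.
Proof.
move=> uD; rewrite -trig_quad_prod// !(trig_quadE eD)//.
by apply: eq_bigr => x _; apply: eq_bigr => y _; rewrite (conj_Creal (ger0_real (f0 y))).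
Qed.

Lemma exists_approximation (E : seq G) (n : nat) : exists u : G -> T,
  [/\ {morph u : x y / x + y},
    forall y b, y \in E -> (forall x, `|f (x + y) - f x| <= b) ->
      `|e (u y) - 1| <= D%:R * (b + 2 / n.+1%:R) &
    forall g, g \in l -> `|e (u g - chi g) - 1| <= J%:R^-1].
Proof.
(* The generators [E] serve the final translation estimate, the generators [c] and the bound
   [4 * size c] serve the density of [V]. *)
set M := maxn n (4 * size c); set s := box M (E ++ c).
have sV : (size s)%:R <= (2 * size c)%:R * \sum_(x <- s) (V x)%:R :> C.
  apply: avg_box_cover; [exact: cov| |exact: leq_maxr].
  by move=> x xc; rewrite mem_cat xc orbT.
have [t0 [t1 [t2 [[u0 u1 u2 t20] t12 t01 szt]]]] := exists_nested_boxes s c.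
have le_energy := energy_lower_bound f0 fV V0 u0 u1 u2 t12 t01 cov szt sV.
set W := energy f s t2 in le_energy.
have W0 : 0 <= W by do 4 (apply: sumr_ge0 => ? _); rewrite !mulr_ge0.
set N0 := (\sum_(x <- Q) \sum_(y <- Q) (x == y))%N.
have coin : (size Q ^ 2 <= m * N0)%N.
  have := coincidences_lower_bound (@sumset_box _ (kernel_exp l) (kernel_width J l) l).
  by rewrite size_box.
pose PS := trig_quad s (fun x y => f x * f y).
pose PB := trig_quad t2 (fun x y => f x * f y).
(* Up to a positive factor this is [(kap - 1 / (2 * m)) |phi|^2 |Phi|^2 - D^-2 |Phi|^2] with
   denominators cleared. *)
pose p := trig_scale (2 * m * D ^ 2)%:R (trig_mul (trig_mul K PS) PB) ++
  (trig_scale (- (D ^ 2 * size Q ^ 2)%:R) (trig_mul PS PB) ++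
   trig_scale (- (2 * m * size Q ^ 2 * size s ^ 2)%:R) PB).
have m0 : (0 < m)%N by rewrite expn_gt0.
have q0 : (0 < size Q)%N by rewrite size_sumset size_box !expn_gt0.
have s0 : (0 < size s)%N by rewrite size_box expn_gt0.
have c0 : (0 < size c)%N by have [i + _] := cov 0; case: (c).
have b0 : (0 < size t2)%N by case: (t2) t20.
have mp : 0 < mean p.
  rewrite /p !mean_cat !meanZ mean_kernel_energy mean_energy -/N0 -/W.
  have mB : mean PB <= (size t2)%:R := mean_quad_f u2.
  have P0 : 0 < (128 * size c ^ 3)%:R :> C by rewrite ltr0n muln_gt0 expn_gt0 c0.
  have key : (2 * m * size Q ^ 2 * size s ^ 2)%:R * mean PB < (D ^ 2 * size Q ^ 2)%:R * W.
    rewrite -(ltr_pM2l P0).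
    apply: (@le_lt_trans _ _
      (256 * m * size c ^ 3 * (size Q ^ 2 * size s ^ 2 * size t2))%:R).
      apply: le_trans (_ : (128 * size c ^ 3)%:R *
        ((2 * m * size Q ^ 2 * size s ^ 2)%:R * (size t2)%:R) <= _).
        by rewrite ler_wpM2l// ler_wpM2l.
      by rewrite -!natrM ler_nat; apply/eq_leq; ring.
    apply: (@lt_le_trans _ _ (D ^ 2 * (size Q ^ 2 * size s ^ 2 * size t2))%:R).
      rewrite ltr_nat ltn_pmul2r ?muln_gt0 ?expn_gt0 ?q0 ?s0//.
      by rewrite -[X in (_ < X)%N]mulnn; apply: leq_pmulr.
    rewrite [leRHS](_ : _ = (D ^ 2 * size Q ^ 2)%:R *
        ((128 * size c ^ 3)%:R * W)); last by rewrite mulrCA.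
    rewrite [leLHS](_ : _ = (D ^ 2 * size Q ^ 2)%:R *
        (size s ^ 2 * size t2)%:R); last by rewrite -natrM !mulnA.
    by rewrite ler_wpM2l.
  (* By [coin] the kernel term is at least twice the subtracted energy term; the spare half absorbs
     the last term by [key]. *)
  have le2 : (D ^ 2 * size Q ^ 2)%:R * W + (D ^ 2 * size Q ^ 2)%:R * W <=
      (2 * m * D ^ 2)%:R * (N0%:R * W).
    rewrite -mulrDl -natrD mulrA -natrM ler_wpM2r// ler_nat addnn -mul2n.
    apply: (@leq_trans (2 * D ^ 2 * (m * N0))).
      by rewrite mulnA leq_mul2l coin orbT.
    by apply/eq_leq; ring.
  rewrite !mulNr addrA subr_gt0 (lt_le_trans key)// lerBrDr.
  exact: le_trans le2.
have [|u uD] := exists_trig_gt0 eD norm_e e_eq1 separation _ mp.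
  move=> u uD; rewrite /p !trig_cat !trigZ !(trigM eD)// trig_quad_prod//.
  by rewrite !trig_quad_f.
rewrite /p !trig_cat !trigZ !(trigM eD)// trig_quad_prod// !trig_quad_f//.
set X := `|\sum_(x <- t2) _| ^+ 2.
pose psi x := e (u x - chi x).
have psiD : {morph psi : x y / x + y >-> x * y}.
  by move=> x y; rewrite /psi uD chiD opprD addrACA; exact: eD.
have psi1 x : `|psi x| = 1 by exact: norm_e.
set a := kernel_exp l; set kap := `|avg (box (kernel_width J l) l) psi| ^+ (2 * a).
have -> : `|\sum_(x <- Q) e (- chi x) * e (u x)| ^+ 2 = (size Q)%:R ^+ 2 * kap.
  rewrite /kap mulnC exprM -exprMn -[`|avg _ _| ^+ a]normrX -avg_sumset//; last first.
    by rewrite /psi (morph_add0 uD) (morph_add0 chiD) subrr e_0.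
  rewrite -[X in _ = (X * _) ^+ _]normr_nat -normrM /avg mulrC divfK.
    by congr (`|_| ^+ _); apply: eq_bigr => x _; rewrite -eD addrC.
  by rewrite pnatr_eq0 -lt0n.
set phi := `|avg s (fun x => f x * e (u x))|.
have -> : `|\sum_(x <- s) f x * e (u x)| ^+ 2 = (size s)%:R ^+ 2 * phi ^+ 2.
  rewrite -exprMn -[X in (X * _) ^+ _]normr_nat -normrM /avg mulrC divfK//.
  by rewrite pnatr_eq0 -lt0n.
rewrite [ltRHS](_ : _ = (size Q)%:R ^+ 2 * (size s)%:R ^+ 2 *
  (X * (D%:R ^+ 2 * phi ^+ 2 * ((2 * m)%:R * kap - 1) - (2 * m)%:R))); last first.
  by rewrite !natrM !natrX; ring.
rewrite pmulr_rgt0; last by rewrite mulr_gt0 ?exprn_gt0 ?ltr0n.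
have X0 : 0 <= X by rewrite exprn_ge0.
rewrite le0r in X0; case/predU1P: X0 => [->|X0]; first by rewrite mul0r ltxx.
rewrite pmulr_rgt0// subr_gt0 => big.
have kap1 : kap <= 1.
  rewrite exprn_ile1// ler_norm_avg// => x; by rewrite psi1.
have m0' : 0 < (2 * m)%:R :> C by rewrite ltr0n muln_gt0.
have Dphi0 : 0 <= D%:R * phi by rewrite mulr_ge0// normr_ge0.
have kap_gt : 1 < (2 * m)%:R * kap.
  rewrite real_ltNge ?real1 ?ger0_real ?mulr_ge0 ?exprn_ge0//; apply/negP => le1.
  have := lt_trans m0' big; rewrite le_gtF// mulr_ge0_le0 ?subr_le0//.
  by rewrite -exprMn exprn_ge0.
(* From [big] and [kap <= 1], the factor [2 * m * kap - 1] is at most [2 * m], so [(D * phi) ^ 2]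
   exceeds [1]. *)
have Dphi : 1 < D%:R * phi.
  rewrite -(ltr_pXn2r (ltn0Sn 1)) ?nnegrE//; rewrite expr1n exprMn.
  rewrite -(ltr_pM2l m0') mulr1 (lt_le_trans big)// mulrC.
  rewrite ler_wpM2r//; first by rewrite -exprMn exprn_ge0.
  rewrite lerBlDr (le_trans (_ : _ <= (2 * m)%:R))//; first by rewrite ler_piMr// ltW.
  by rewrite lerDl.
exists u; split=> //; last first.
  move=> g gl; exact: (kernel_concentration J0 psiD psi1 kap_gt gl).
(* Multiplying the average of [F] by [e (u y)] is compared with translating [F] by [y]: the first
   error comes from the variation of [f], the second from the Folner property. *)
move=> y b yE fb; have shift : `|e (u y) - 1| * phi <= b + 2 / M.+1%:R.
  rewrite /phi -normrM mulrBl mul1r.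
  set F := fun x => f x * e (u x).
  have -> : e (u y) * avg s F - avg s F =
    (e (u y) * avg s F - avg s (fun x => F (x + y))) +
    (avg s (fun x => F (x + y)) - avg s F).
    by rewrite addrA subrK.
  apply: le_trans (ler_normD _ _) _; rewrite lerD//.
    rewrite -avgMl avgB ler_norm_avg//; first exact: le_trans (fb 0).
    move=> x; rewrite /F uD eD [e (u x) * _]mulrC mulrCA -mulrBl.
    by rewrite normrM normrM !norm_e !mulr1 distrC fb.
  apply: avg_box_shift; first by rewrite mem_cat yE.
  by move=> x; rewrite normrM norm_e mulr1 ger0_norm.
have b0' : 0 <= b by exact: le_trans (fb 0).
apply: le_trans (_ : `|e (u y) - 1| * (D%:R * phi) <= _).
  by rewrite ler_peMr// ltW.
rewrite mulrCA ler_wpM2l// (le_trans shift)// lerD2l ler_wpM2l//.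
by rewrite lef_pV2 ?posrE ?ltr0n// ler_nat ltnS leq_maxl.
Qed.

End approximation.

Local Open Scope classical_set_scope.
Local Open Scope quotient_scope.
Local Open Scope ring_scope.

(** Euclidean division by the least positive element; [d = 0] when there is none. Truncated
    subtraction stands in for differences in a subgroup of the integers. *)
Lemma nat_subgroup_generator (S : set nat) : S 0 ->
  (forall i j, S i -> S j -> S (i - j)%N) ->
  exists2 d, S d & forall n, S n -> (d %| n)%N.
Proof.
move=> S0 SB; have [[n [n0 Sn]]|nS] := pselect (exists n, (0 < n)%N /\ S n); last first.
  exists 0 => // n Sn; rewrite dvd0n; apply/eqP; apply: contrapT => /eqP.
  by rewrite -lt0n => n0; apply: nS; exists n.
have exS : exists n, (0 < n)%N && `[< S n >] by exists n; rewrite n0; apply/asboolP.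
case: (ex_minnP exS) => d /andP[d0 /asboolP Sd] dmin; exists d => // k Sk.
have Sr q : S (k - q * d)%N.
  by elim: q => [|q IHq]; rewrite ?mul0n ?subn0// mulSn addnC subnDA; exact: SB.
rewrite /dvdn -leqn0 leqNgt; apply/negP => r0.
have := dmin (k %% d)%N; rewrite r0/= leqNgt ltn_mod d0 => /(_ _)/negP; apply.
  apply/asboolP; rewrite (_ : (k %% d)%N = (k - k %/ d * d)%N)//.
  by rewrite {2}(divn_eq k d) addKn.
by [].
Qed.

(** * Extension of homomorphisms into the circle *)

Section partial_morphisms.
Context (R : realType) (G : zmodType).
Local Notation T := (circle R).

Lemma pi_circleMn (x : R) n : (\pi_T x : T) *+ n = \pi_T (x *+ n).
Proof.
by elim: n => [|n IHn]; rewrite ?mulr0n ?pi_circle0// !mulrS pi_circleD IHn.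
Qed.

Lemma circle_divisible (t : T) n : (0 < n)%N -> exists s : T, s *+ n = t.
Proof.
move=> n0; exists (\pi_T (repr t / n%:R)).
by rewrite pi_circleMn -(mulr_natr (repr t / _)) divfK ?reprK// pnatr_eq0 -lt0n.
Qed.

(* Partial morphisms are represented by their graphs. *)
Definition partial_morph (A : set (G * T)) :=
  [/\ A (0, 0), forall x y s t, A (x, s) -> A (y, t) -> A (x - y, s - t) &
    forall t, A (0, t) -> t = 0].

Section graph.
Context (A : set (G * T)) (pA : partial_morph A).

Lemma partial_morphB x y s t : A (x, s) -> A (y, t) -> A (x - y, s - t).
Proof. by have [_ + _] := pA; apply. Qed.

Lemma partial_morphN x s : A (x, s) -> A (- x, - s).
Proof. by have [A0 _ _] := pA; move/(partial_morphB A0); rewrite !sub0r. Qed.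

Lemma partial_morphD x y s t : A (x, s) -> A (y, t) -> A (x + y, s + t).
Proof. by move=> As /partial_morphN /(partial_morphB As); rewrite !opprK. Qed.

Lemma partial_morphMn x s n : A (x, s) -> A (x *+ n, s *+ n).
Proof.
move=> As; elim: n => [|n IHn]; first by rewrite !mulr0n; have [] := pA.
by rewrite !mulrS; exact: partial_morphD.
Qed.

Lemma partial_morph_fun x s t : A (x, s) -> A (x, t) -> s = t.
Proof.
move=> As At; apply/eqP; rewrite -subr_eq0; apply/eqP; have [_ _] := pA; apply.
by have := partial_morphB As At; rewrite subrr.
Qed.

(** The multiples of [y] in the domain are those of some [d *+ y]-type generator [y *+ d], whose
    value is divided by [d] in the circle; for [d = 0] any value would do. *)
Lemma partial_morph_extension_value y :
  exists s, forall n t, A (y *+ n, t) -> s *+ n = t.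
Proof.
have [||d [t0 At0] dS] := @nat_subgroup_generator [set n | exists t, A (y *+ n, t)].
- by exists 0; rewrite mulr0n; have [] := pA.
- move=> i j [s As] [t At]; have [ij|/ltnW/eqP ->] := leqP j i; last first.
    by exists 0; rewrite mulr0n; have [] := pA.
  by exists (s - t); rewrite mulrnBr//; exact: partial_morphB.
have [d0|d0] := posnP d.
  exists 0 => n t At; have := dS n (ex_intro _ t At); rewrite d0 dvd0n => /eqP n0.
  by rewrite n0 mulr0n; apply/esym; have [_ _] := pA; apply; rewrite -(mulr0n y) -n0.
have [s st0] := circle_divisible t0 d0; exists s => n t At.
have /dvdnP[q nq] := dS n (ex_intro _ t At).
apply: (@partial_morph_fun (y *+ n)) => //.
by rewrite nq mulnC !mulrnA st0; exact: partial_morphMn.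
Qed.

Definition adjoin (y : G) (s : T) : set (G * T) :=
  [set p | exists a k, A a /\ p = (a.1 + y *~ k, a.2 + s *~ k)].

Lemma sub_adjoin y s : A `<=` adjoin y s.
Proof. by case=> x t Axt; exists (x, t), 0; rewrite !mulr0z !addr0. Qed.

Lemma adjoin_mem y s : adjoin y s (y, s).
Proof. by exists (0, 0), 1; rewrite !add0r !mulr1z; have [] := pA. Qed.

Lemma partial_morph_adjoin y s : (forall n t, A (y *+ n, t) -> s *+ n = t) ->
  partial_morph (adjoin y s).
Proof.
move=> sn; split.
- by apply: sub_adjoin; have [] := pA.
- move=> x x' t t' [[a b] [k [Aab [-> ->]]]] [[a' b'] [k' [Aab' [-> ->]]]] /=.
  exists (a - a', b - b'), (k - k'); split; first exact: partial_morphB.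
  by rewrite /= !mulrzBr !opprD; congr (_, _); rewrite addrACA.
move=> t [[a b] [k [Aab []]]] /= /esym/eqP; rewrite addrC addr_eq0 => /eqP yk ->.
case: k yk => n; rewrite ?NegzE ?mulrNz -!pmulrn => yk.
  by rewrite (sn n (- b)) ?subrr// yk; exact: partial_morphN.
by rewrite (sn n.+1 b) ?subrr// (oppr_inj yk).
Qed.

End graph.

(** Zorn's lemma is applied to the sets whose union with [A0] is a graph, so that the empty chain is
    covered. A maximal one is total, because divisibility allows adjoining any point. *)
Lemma partial_morph_total A0 : partial_morph A0 ->
  exists2 u : G -> T, {morph u : x y / x + y} & forall x t, A0 (x, t) -> u x = t.
Proof.
move=> pA0.
have [F FP Ftot|A [pA Amax]] := @Zorn_bigcup _ [set A | partial_morph (A0 `|` A)].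
  rewrite /=; have [[X FX]|F0] := pselect (exists X, F X); last first.
    rewrite (_ : \bigcup_(X in F) X = set0) ?setU0// -subset0.
    by move=> x [X FX]; case: F0; exists X.
  have step p q : (A0 `|` \bigcup_(X in F) X) p -> (A0 `|` \bigcup_(X in F) X) q ->
      exists2 Y, F Y & (A0 `|` Y) p /\ (A0 `|` Y) q.
    move=> [A0p|[Y FY Yp]] [A0q|[Z FZ Zq]].
    - by exists X => //; split; left.
    - by exists Z => //; split; [left|right].
    - by exists Y => //; split; [right|left].
    - have [YZ|ZY] := Ftot Y Z FY FZ.
        by exists Z => //; split; right => //; exact: YZ.
      by exists Y => //; split; right => //; exact: ZY.
  split.
  - by left; have [] := pA0.
  - move=> x y s t /step /[apply] -[Y FY [As At]].
    have [_ /(_ _ _ _ _ As At) [?|?] _] := FP Y FY; [by left|by right; exists Y].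
  - move=> t At; have [Y FY [{}At _]] := step _ _ At At.
    by have [_ _] := FP Y FY; apply.
set B := A0 `|` A in pA.
have total y : exists s, B (y, s).
  have [s sn] := partial_morph_extension_value pA y; exists s.
  apply: contrapT => nBs; apply: (Amax (adjoin B y s)); last first.
    rewrite /= (_ : A0 `|` _ = adjoin B y s); first exact: partial_morph_adjoin.
    by rewrite setUidr// => p A0p; apply: sub_adjoin; left.
  split; first by move=> p Ap; apply: sub_adjoin; right.
  by move/(_ (y, s) (adjoin_mem pA y s)) => As; apply: nBs; right.
have [u uB] := choice total; exists u => [x y|x t A0x].
  by apply: (partial_morph_fun pA (uB _)); exact: (partial_morphD pA (uB x) (uB y)).
by apply: (partial_morph_fun pA (uB _)); left.
Qed.

Lemma pi_circle_inv_nat (n : nat) : (1 < n)%N ->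
  (\pi_T n%:R^-1 : T) != 0 /\ (\pi_T n%:R^-1 : T) *+ n = 0.
Proof.
move=> n1; split.
  rewrite -[X in _ != X]pi_circle0 pi_circle_eq subr0; apply/negP => /intrP[z zn].
  have n0 : (0 : R) < n%:R by rewrite ltr0n ltnW.
  have : (0 : R) < z%:~R by rewrite -zn invr_gt0.
  have : z%:~R < (1 : R) by rewrite -zn invf_lt1// ltr1n.
  rewrite -[1]/(1%:~R) ltr_int ltr0z => z1 z0.
  by rewrite ltNge -gtz0_ge1 z0 in z1.
rewrite pi_circleMn -(mulr_natr n%:R^-1) mulVf ?pnatr_eq0 -?lt0n ?(ltnW n1)//.
by apply/eqP; rewrite -pi_circle0 pi_circle_eq subr0.
Qed.

(** The point [x] is sent to the class of [1 / n], with [n > 1] dividing every [k] such that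
    [x *+ k] lies in [H]. A value of finite order is what the geometric sums of [orthogonal_family]
    use. *)
Lemma character_separation (H : set G) x : zmod_closed [in H] -> ~ H x ->
  exists u : G -> T, [/\ {morph u : x y / x + y}, forall h, H h -> u h = 0,
    u x != 0 & exists2 n, (0 < n)%N & u x *+ n = 0].
Proof.
move=> [H0 HB] nHx; rewrite inE in H0.
have {}HB y z : H y -> H z -> H (y - z).
  by move=> Hy Hz; have := HB y z; rewrite !inE; apply.
have [||d Hd dH] := @nat_subgroup_generator [set n | H (x *+ n)].
- by rewrite /= mulr0n.
- move=> i j /= Hi Hj; have [ij|/ltnW/eqP ->] := leqP j i; last by rewrite mulr0n.
  by rewrite mulrnBr//; exact: HB.
have [n n1 nH] : exists2 n, (1 < n)%N & forall k, H (x *+ k) -> (n %| k)%N.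
  have [d0|d0] := posnP d.
    (* If [x] has infinite order modulo [H], the choice is free and [1/2] is taken. *)
    by exists 2 => // k /dH; rewrite d0 dvd0n => /eqP->; rewrite dvdn0.
  exists d => //; rewrite ltn_neqAle d0 andbT; apply/eqP => d1.
  by apply: nHx; move: Hd; rewrite /= -d1 mulr1n.
have [s0 sn] := pi_circle_inv_nat n1; set s : T := \pi_T _ in s0 sn.
pose A := [set p : G * T | H p.1 /\ p.2 = 0].
have pA : partial_morph A.
  split=> //=.
    by move=> ? ? ? ? [/= Hy ->] [/= Hz ->]; split; [exact: HB|rewrite subrr].
  by move=> t [].
have [|u uD uA] := partial_morph_total (@partial_morph_adjoin _ pA x s _).
  by move=> k t [/= /nH/dvdnP[q ->] ->]; rewrite mulnC mulrnA sn mul0rn.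
have ux : u x = s by apply: uA; exact: adjoin_mem.
exists u; split=> //; [|by rewrite ux|by exists n; rewrite ?ux// ltnW].
by move=> h Hh; apply: uA; exact: sub_adjoin.
Qed.

End partial_morphisms.

Import complex.

(** * The circle as the group of unit complex numbers *)

Section circle_character.
Context (R : realType).
Local Notation T := (circle R).
Implicit Types (s t : T) (x y : R).

Definition circle_cos t : R := cos (pi *+ 2 * repr t).
Definition circle_sin t : R := sin (pi *+ 2 * repr t).
Definition circle_exp t : complex R := Complex (circle_cos t) (circle_sin t).

Lemma periodic_int (f : R -> R) a : periodic f a -> forall k x, f (x + a *~ k) = f x.
Proof.
move=> fa [] n x; first exact: periodicn.
by rewrite NegzE mulrNz -[in RHS](subrK (a *+ n.+1) x) periodicn.
Qed.

Lemma circle_lift (f : R -> R) x : periodic f (pi *+ 2) ->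
  f (pi *+ 2 * repr (\pi_T x : T)) = f (pi *+ 2 * x).
Proof.
move=> fpi; have : \pi_T (repr (\pi_T x : T)) == \pi_T x :> T by rewrite reprK.
rewrite pi_circle_eq => /intrP[k kE]; rewrite -(subrK x (repr _)) kE.
by rewrite mulrDr addrC mulrzr periodic_int.
Qed.

Lemma circle_cos_pi x : circle_cos (\pi_T x) = cos (pi *+ 2 * x).
Proof. exact/circle_lift/cosD2pi. Qed.

Lemma circle_sin_pi x : circle_sin (\pi_T x) = sin (pi *+ 2 * x).
Proof. exact/circle_lift/sinD2pi. Qed.

Lemma circle_expD : {morph circle_exp : s t / s + t >-> s * t}.
Proof.
move=> s t; rewrite /circle_exp -(reprK s) -(reprK t) -pi_circleD.
rewrite !circle_cos_pi !circle_sin_pi mulrDr cosD sinD.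
by congr Complex; rewrite addrC.
Qed.

(** Later estimates use the square [2 - 2 * circle_cos t] of this distance, which is real and
    continuous in [t]. *)
Lemma norm_circle_expB1 t :
  `|circle_exp t - 1| = (Num.sqrt (2 - 2 * circle_cos t))%:C%C.
Proof.
rewrite normc_def/=; congr (Num.sqrt _)%:C%C.
have := cos2Dsin2 (pi *+ 2 * repr t); rewrite -/(circle_cos t) -/(circle_sin t).
by rewrite oppr0 addr0 => cs; nra.
Qed.

Lemma norm_circle_exp t : `|circle_exp t| = 1.
Proof.
rewrite normc_def/=.
have := cos2Dsin2 (pi *+ 2 * repr t); rewrite -/(circle_cos t) -/(circle_sin t) => ->.
by rewrite sqrtr1.
Qed.

Lemma circle_cos_le1 t : circle_cos t <= 1.
Proof. exact: cos_le1. Qed.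

Lemma circle_cos0 : circle_cos 0 = 1.
Proof. by rewrite -pi_circle0 circle_cos_pi mulr0 cos0. Qed.

Lemma circle_representative t : exists2 x : R, `|x| <= 2^-1 & t = \pi_T x.
Proof.
pose y := repr t + 2^-1; exists (repr t - (Num.floor y)%:~R).
  have /andP[y0 y1] := floor_itv y.
  rewrite ler_norml; apply/andP; split.
    by move: y0; rewrite /y; lra.
  by move: y1; rewrite intrD /y; lra.
rewrite -{1}(reprK t); apply/eqP; rewrite pi_circle_eq opprB addrC subrK.
by rewrite intr_int.
Qed.

Let twopi_gt0 : 0 < pi *+ 2 :> R.
Proof. by rewrite pmulrn_lgt0 ?pi_gt0. Qed.

Lemma angle_itv x : `|x| <= 2^-1 -> pi *+ 2 * `|x| \in `[0, pi].
Proof.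
move=> x2; rewrite in_itv/= mulr_ge0 ?(ltW twopi_gt0)//=.
have := pi_ge0 R; have := normr_ge0 x; rewrite -mulr_natr; nra.
Qed.

Lemma circle_cos_norm x : circle_cos (\pi_T x) = cos (pi *+ 2 * `|x|).
Proof.
by rewrite circle_cos_pi -cos_norm normrM (gtr0_norm twopi_gt0).
Qed.

Lemma circle_cos_eq1 t : circle_cos t = 1 -> t = 0.
Proof.
have [x x2 ->] := circle_representative t; rewrite circle_cos_norm -(@cos0 R).
move/cos_inj => /(_ (angle_itv x2)); rewrite in_itv/= lexx pi_ge0 => /(_ isT)/eqP.
rewrite mulf_eq0 mulrn_eq0/= gt_eqF ?pi_gt0//= normr_eq0 => /eqP->.
exact: pi_circle0.
Qed.

Lemma circle_exp_eq1 t : circle_exp t = 1 -> t = 0.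
Proof. by case=> /circle_cos_eq1. Qed.

Lemma circle_nbhs0_cos (U : set T) : nbhs (0 : T) U ->
  exists2 d : R, 0 < d & forall t, 1 - circle_cos t < d -> U t.
Proof.
rewrite -[0]pi_circle0 => /pi_circle_continuous /nbhs_ballP[r /= r0 rU].
(* The cap [1/2] keeps [2 pi q] in [[0, pi]], where the cosine is decreasing. *)
pose q := Num.min r 2^-1.
have q0 : 0 < q by rewrite lt_min r0 invr_gt0 ltr0n.
have q2 : `|q| <= 2^-1 by rewrite gtr0_norm// ge_min lexx orbT.
exists (1 - cos (pi *+ 2 * q)).
  rewrite subr_gt0 -(@cos0 R) ltr_cos ?in_itv/= ?lexx ?pi_ge0//.
    by rewrite mulr_gt0.
  by have := angle_itv q2; rewrite gtr0_norm// in_itv.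
move=> t; have [x x2 ->] := circle_representative t.
rewrite circle_cos_norm ltrD2l ltrN2 ltr_cos ?angle_itv//; last first.
  by have := angle_itv q2; rewrite gtr0_norm.
rewrite ltr_pM2l// => xq.
by apply: rU; rewrite /ball/= sub0r normrN (lt_le_trans xq)// ge_min lexx.
Qed.

Lemma circle_cos_continuous : continuous circle_cos.
Proof.
apply/continuousP => A oA; rewrite /open/= /circle_open.
rewrite (_ : _ @^-1` _ = (fun x => cos (pi *+ 2 * x)) @^-1` A); last first.
  by apply/seteqP; split=> x /=; rewrite circle_cos_pi.
move: A oA; apply/continuousP => x.
apply: continuous_comp; last exact: continuous_cos.
exact: mulrl_continuous.
Qed.

Lemma circle_compact : compact [set: T].
Proof.
have -> : [set: T] = (fun x => \pi_T x : T) @` `[- 2^-1, 2^-1].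
  apply/seteqP; split=> // t _; have [x x2 ->] := circle_representative t.
  by exists x => //=; rewrite in_itv/= -ler_norml.
apply: continuous_compact; last exact: segment_compact.
by apply: continuous_subspaceT; exact: pi_circle_continuous.
Qed.

End circle_character.

Lemma ultra_cvg_compact (I : Type) (X : topologicalType) (F : set_system I)
    (g : I -> X) : UltraFilter F -> compact [set: X] -> exists x : X, g @ F --> x.
Proof.
move=> UF cX; have [x [_ clx]] := cX (g @ F) (fmap_proper_filter _ _) filterT.
exists x => W xW; have [//|nW] := in_ultra_setVsetC (g @^-1` W) UF.
by have [y []] := clx (~` W) W nW xW.
Qed.

(** * Continuous characters of a compact group *)

Section enlarging.
Context (X : eqType).

(** The tails of the directed set of pairs (finite list, precision): each point is eventually listed
    and each precision eventually reached. *)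
Definition enlarging : set_system (seq X * nat) :=
  filter_from [set: seq X * nat]
    (fun i => [set j : seq X * nat | {subset i.1 <= j.1} /\ (i.2 <= j.2)%N]).

Global Instance enlarging_filter : ProperFilter enlarging.
Proof.
apply: filter_from_proper; last by move=> i _; exists i; split.
apply: filter_from_filter; first by exists ([::], 0).
move=> i j _ _; exists (i.1 ++ j.1, maxn i.2 j.2) => // k [/= ijk nk].
split; split; try (by rewrite (leq_trans _ nk)// (leq_maxl, leq_maxr));
  by move=> x xi; apply: ijk; rewrite mem_cat xi ?orbT.
Qed.

Lemma enlarging_mem x : \forall i \near enlarging, x \in i.1.
Proof. by exists ([:: x], 0) => //= i [+ _]; apply; rewrite mem_head. Qed.

Lemma enlarging_ge n : \forall i \near enlarging, (n <= i.2)%N.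
Proof. by exists ([::], n) => //= i []. Qed.

End enlarging.

Section topological_group.
Context (R : realType) (K : topologicalZmodType).
Local Notation T := (circle R).

Lemma nbhs0_sub (W : set K) : nbhs 0 W ->
  exists2 U : set K, nbhs 0 U & forall x y, U x -> U y -> W (x - y).
Proof.
move=> W0; have := @sub_continuous K (0, 0) W; rewrite /= subrr => /(_ W0).
case=> -[A B] /= [A0 B0] AB; exists (A `&` B); first exact: filterI.
by move=> x y [Ax _] [_ By]; exact: (AB (x, y)).
Qed.

Lemma nbhs0_add (W : set K) : nbhs 0 W ->
  exists2 U : set K, nbhs 0 U & forall x y, U x -> U y -> W (x + y).
Proof.
move=> W0; have := @add_continuous K (0, 0) W; rewrite /= addr0 => /(_ W0).
case=> -[A B] /= [A0 B0] AB; exists (A `&` B); first exact: filterI.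
by move=> x y [Ax _] [_ By]; exact: (AB (x, y)).
Qed.

Lemma translation_continuous (x : K) : continuous (fun y => y - x).
Proof.
move=> y; apply: (@continuous_comp _ _ _ (fun y => (y, x)) (fun z : K * K => z.1 - z.2)).
  by apply: cvg_pair => /=; [exact: cvg_id|exact: cvg_cst].
exact: sub_continuous.
Qed.

Context (compactK : compact [set: K]).

(** Compactness in its near-covering form, with finite lists of centres as parameter: near [x], any
    list containing [x] works. *)
Lemma finite_translates_cover (V : set K) : nbhs 0 V ->
  exists c : seq K, forall x, exists2 i, i \in c & V (x - i).
Proof.
move=> V0; have near_cover := (@compact_near_coveringP K setT).1 compactK.
have ncov : \forall i \near @enlarging K, [set: K] `<=`
    [set x | exists2 g, g \in i.1 & V (x - g)].
  apply: near_cover => x _.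
  exists ((fun y => y - x) @^-1` V, [set i : seq K * nat | x \in i.1]).
    split; last exact: enlarging_mem.
    by apply: translation_continuous; rewrite subrr.
  by move=> [y i] /= [Vyx xi]; exists x.
have [i cov] := @filter_ex _ _ (enlarging_filter K) _ ncov.
by exists i.1 => x; exact: cov.
Qed.

Lemma uniformly_continuous_translation (f : K -> R) : continuous f ->
  forall eps, 0 < eps -> \forall y \near (0 : K), forall x, `|f (x + y) - f x| < eps.
Proof.
move=> cf eps eps0.
have near_cover := (@compact_near_coveringP K setT).1 compactK.
have cg : continuous (fun z : K * K => f (z.1 + z.2) - f z.1).
  move=> z; apply: continuousB.
    by apply: (continuous_comp (@add_continuous K z)); exact: cf.
  by apply: continuous_comp; [exact: cvg_fst|exact: cf].
suff ncov : \forall y \near (0 : K), [set: K] `<=` [set x | `|f (x + y) - f x| < eps].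
  by apply: filterS ncov => y + x; exact.
apply: near_cover => x _.
have := cg (x, 0); rewrite /continuous_at/= addr0 subrr => /cvgr0_norm_lt.
by move=> /(_ _ eps0).
Qed.

Context (hausdorffK : hausdorff_space K).

Lemma nbhs0_avoid (s : seq K) :
  \forall y \near (0 : K), forall x, x \in s -> y = x -> x = 0.
Proof.
elim: s => [|a s IHs]; first by apply: nearW => y x; rewrite in_nil.
have [a0|a0] := eqVneq a 0.
  apply: filterS IHs => y ys x; rewrite inE => /predU1P[->//|]; exact: ys.
have : nbhs (0 : K) (~` [set a]).
  apply: open_nbhs_nbhs; split; last by move=> /= a0'; rewrite a0' eqxx in a0.
  rewrite openC; exact: (accessible_closed_set1 (hausdorff_accessible hausdorffK)).
move: IHs; apply: filterS2 => y ys ya x; rewrite inE => /predU1P[->|]; last exact: ys.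
by move=> /ya.
Qed.

Lemma continuous_bump (U : set K) : nbhs 0 U -> exists f : K -> R,
  [/\ continuous f, f 0 = 1, forall x, 0 <= f x <= 1 & forall x, f x != 0 -> U x].
Proof.
move=> U0; have cr : completely_regular_space K.
  have aK := hausdorff_accessible hausdorffK.
  exact: (@normal_completely_regular R K (compact_normal hausdorffK compactK) aK).
have sep : uniform_separator [set (0 : K)] (~` U^°).
  apply: cr; first by apply: open_closedC; exact: open_interior.
  by apply; exact: nbhs_singleton (nbhs_interior U0).
exists (fun x => 1 - @Urysohn K R [set 0] (~` U^°) x); split.
- move=> x; apply: continuousB; first exact: cvg_cst.
  exact: Urysohn_continuous.
- have /= -> // := @Urysohn_sub0 K R _ _ sep (@Urysohn K R [set 0] (~` U^°) 0).
    by rewrite subr0.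
  by exists 0.
- move=> x; have := @Urysohn_range K R [set 0] (~` U^°) _
    (imageP _ I : range _ (@Urysohn K R [set 0] (~` U^°) x)).
  by rewrite /= in_itv/=; lra.
move=> x fx; apply: contrapT => nUx; move/eqP: fx; apply.
have /= -> // := @Urysohn_sub1 K R _ _ sep (@Urysohn K R [set 0] (~` U^°) x).
  by rewrite subrr.
by exists x => //= /interior_subset.
Qed.

End topological_group.

(** * Pointwise approximation of arbitrary homomorphisms by continuous characters *)

Section density.
Context (R : realType).
Local Notation T := (circle R).
Local Notation C := (complex R).

Lemma point_separation (G : zmodType) (y : G) : y != 0 -> exists v : G -> T,
  [/\ {morph v : x y / x + y}, v y != 0 & exists2 n, (0 < n)%N & v y *+ n = 0].
Proof.
move=> y0; have [||u [uD _ uy un]] := @character_separation R G [set 0] y.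
- by split=> [|a b]; rewrite !inE// => -> ->; rewrite subr0.
- by move/eqP; rewrite (negbTE y0).
by exists u.
Qed.

Context (K : topologicalZmodType) (compactK : compact [set: K]).
Context (hausdorffK : hausdorff_space K).

Lemma approximation_cos (chi : K -> T) (l : seq K) (J : nat) :
  {morph chi : x y / x + y} -> (0 < J)%N ->
  exists (f : K -> R) (D : nat), [/\ continuous f, (0 < D)%N &
  forall (E : seq K) (n : nat), exists u : K -> T,
  [/\ {morph u : x y / x + y},
    forall y b, y \in E -> (forall x, `|f (x + y) - f x| <= b) ->
      2 - 2 * circle_cos (u y) <= (D%:R * (b + 2 / n.+1%:R)) ^+ 2 &
    forall g, g \in l -> 2 - 2 * circle_cos (u g - chi g) <= (J%:R^-1) ^+ 2]].
Proof.
move=> chiD J0; pose Q := kernel_support J l.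
(* [U] is chosen so that [(U - U) + (U - U)] contains no nonzero difference of entries of [Q]; this
   yields [supp] for a bump supported in [U]. *)
have [U1 U10 U1P] := nbhs0_add (nbhs0_avoid hausdorffK [seq y - x | x <- Q, y <- Q]).
have [U U0 UP] := nbhs0_sub U10.
have [f [cf f01 f_itv fU]] := continuous_bump R compactK hausdorffK U0.
have W0 : nbhs (0 : K) (f @^-1` [set r | 2^-1 < r]).
  apply: cf; apply: open_nbhs_nbhs; split; first exact: open_gt.
  by rewrite /= f01 invf_lt1// ltr1n.
have [V V0 VP] := nbhs0_add W0.
have [c cov] := finite_translates_cover compactK V0.
pose fC x : C := (f x)%:C%C.
pose D := approximation_constant l J c.
have real_le (t : T) (b : R) : 0 <= b ->
    `|circle_exp t - 1| <= b%:C%C -> 2 - 2 * circle_cos t <= b ^+ 2.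
  move=> b0; rewrite norm_circle_expB1 lecR => tb.
  rewrite -(@sqr_sqrtr _ (2 - _)); first by rewrite lerXn2r ?nnegrE ?sqrtr_ge0.
  by have := circle_cos_le1 t; lra.
have f0 x : 0 <= fC x by rewrite /fC ler0c; have /andP[] := f_itv x.
have f1 x : fC x <= 1 by rewrite /fC (lecR (f x) 1); have /andP[] := f_itv x.
pose Vb : pred K := fun x => `[< V x >].
have fV x z : Vb x -> Vb z -> 2^-1 <= fC (x + z).
  move=> /asboolP Vx /asboolP Vz; have := VP _ _ Vx Vz; rewrite /= /fC => /ltW.
  by rewrite -lecR fmorphV rmorph_nat.
have V0' : Vb 0 by apply/asboolP; exact: nbhs_singleton V0.
have covb x : exists2 i, i \in c & Vb (x - i).
  by have [i ic Vi] := cov x; exists i => //; exact/asboolP.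
have supp t t' : t \in Q -> t' \in Q -> forall x x' z z',
    fC x != 0 -> fC x' != 0 -> fC z != 0 -> fC z' != 0 ->
    t - t' + (x - x') + (z - z') = 0 -> t = t'.
  have fCU x : fC x != 0 -> U x by rewrite /fC fmorph_eq0; exact: fU.
  move=> tQ t'Q x x' z z' /fCU Ux /fCU Ux' /fCU Uz /fCU Uz'.
  rewrite -addrA => /eqP; rewrite addrC addr_eq0 opprB => /eqP xE.
  have := U1P _ _ (UP _ _ Ux Ux') (UP _ _ Uz Uz') (t' - t) _ xE.
  rewrite (allpairs_f (fun x y => y - x))// => /(_ isT)/eqP.
  by rewrite subr_eq0 => /eqP.
exists f, D; split=> // E n.
have [u [uD uE ul]] := exists_approximation (@circle_expD R) (@norm_circle_exp R)
  (@circle_exp_eq1 R) (@point_separation K) chiD J0 f0 f1 fV V0' covb supp E n.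
exists u; split=> // [y b yE fb|g gl].
  have b0 : 0 <= b by exact: le_trans (fb 0).
  apply: real_le; first by rewrite mulr_ge0// addr_ge0// divr_ge0.
  rewrite rmorphM rmorphD fmorph_div !rmorph_nat; apply: uE => // x.
  rewrite /fC -rmorphB normc_def/= expr0n/= addr0 sqrtr_sqr lecR; exact: fb.
apply: real_le; first by rewrite invr_ge0.
by rewrite fmorphV rmorph_nat; exact: ul.
Qed.

Lemma continuous_approximation (chi : K -> T) (l : seq K) (J : nat) :
  {morph chi : x y / x + y} -> (0 < J)%N ->
  exists2 u : K -> T, dual u &
    forall g, g \in l -> 2 - 2 * circle_cos (u g - chi g) <= (J%:R^-1) ^+ 2.
Proof.
move=> chiD J0; have [f [D [cf D0 app]]] := approximation_cos l chiD J0.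
have [v vP] := choice (fun i : seq K * nat => app i.1 i.2).
have [F [UF sF]] := ultraFilterLemma (enlarging_filter K).
have FF : ProperFilter F by exact: ultra_proper.
have [u vu] := choice (fun y =>
  ultra_cvg_compact (fun i => v i y) UF (@circle_compact R)).
have cos_cvg (g : seq K * nat -> T) t : g @ F --> t ->
    (fun i => circle_cos (g i)) @ F --> circle_cos t.
  by move=> gt; apply: continuous_cvg => //; exact: circle_cos_continuous.
have cvgB (g h : seq K * nat -> T) s t : g @ F --> s -> h @ F --> t ->
    (fun i => g i - h i) @ F --> s - t.
  move=> gs ht; have cT := @sub_continuous T (s, t).
  exact: (@continuous2_cvg _ _ _ _ F _ g h (fun a b : T => a - b) s t cT gs ht).
have cos_le (g : seq K * nat -> T) t b : g @ F --> t ->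
    (\forall i \near F, 2 - 2 * circle_cos (g i) <= b) -> 2 - 2 * circle_cos t <= b.
  move=> /cos_cvg gt gb; suff : 1 - b / 2 <= circle_cos t by lra.
  apply: (@closed_cvg _ _ F FF _ [set r | 1 - b / 2 <= r] _ _ _ gt).
    exact: closed_ge.
  by apply: filterS gb => i /=; lra.
have uD : {morph u : x y / x + y}.
  move=> x y; apply/eqP; rewrite -subr_eq0; apply/eqP/circle_cos_eq1.
  have : 2 - 2 * circle_cos (u (x + y) - u x - u y) <= 0.
    apply: (cos_le (fun i => v i (x + y) - v i x - v i y)).
      exact: (cvgB _ _ _ _ (cvgB _ _ _ _ (vu (x + y)) (vu x)) (vu y)).
    apply: nearW => i; have [vD _ _] := vP i.
    by rewrite vD [v i x + _]addrC addrK subrr circle_cos0; lra.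
  rewrite opprD addrA => H; apply/eqP; rewrite eq_le circle_cos_le1/=.
  by move: H; lra.
(* For fixed [y] and [n], eventually [y] is listed and the precision is at least [n]; the bound then
   passes to the limit. *)
have ubound y b n : (forall x, `|f (x + y) - f x| <= b) ->
    2 - 2 * circle_cos (u y) <= (D%:R * (b + 2 / n.+1%:R)) ^+ 2.
  move=> fb; apply: (cos_le (fun i => v i y) _ _ (vu y)).
  have FI := @filterI _ F FF _ _ (sF _ (enlarging_mem y)) (sF _ (enlarging_ge K n)).
  apply: (@filterS _ F FF _ _ _ FI) => i [/= yi ni]; have [_ /(_ y b yi fb) vb _] := vP i.
  have b0 : 0 <= b by exact: le_trans (fb 0).
  apply: le_trans vb _; rewrite lerXn2r ?nnegrE ?mulr_ge0 ?addr_ge0 ?divr_ge0//.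
  by rewrite ler_wpM2l// lerD2l ler_wpM2l// lef_pV2 ?posrE ?ltr0n// ler_nat.
exists u; last first.
  move=> g gl; apply: (cos_le (fun i => v i g - chi g)).
    by apply: (cvgB _ _ _ _ (vu g)); exact: cvg_cst.
  by apply: nearW => i; have [_ _] := vP i; apply.
split=> //.
have u0 : u y @[y --> (0 : K)] --> (0 : T).
  move=> U /circle_nbhs0_cos[d d0 dU].
  (* With [eps = eta / (2 D)] and [2 / n.+1 <= eps], the bound is at most [eta ^ 2], and [eta <= 1]
     gives [eta ^ 2 <= d]. *)
  pose eta := Num.min 1 d; have eta0 : 0 < eta by rewrite lt_min ltr01.
  have D0' : 0 < D%:R :> R by rewrite ltr0n.
  pose eps := eta / (2 * D%:R).
  have eps0 : 0 < eps by rewrite divr_gt0// mulr_gt0.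
  pose n := Num.truncn (2 / eps).
  have neps : 2 / n.+1%:R <= eps.
    rewrite ler_pdivrMr ?ltr0n// mulrC -ler_pdivrMr// ltW//.
    exact: truncnS_gt.
  have near_f := uniformly_continuous_translation compactK cf eps0.
  apply: filterS near_f => y fy; apply: dU.
  have := @ubound y eps n (fun x => ltW (fy x)).
  have : (D%:R * (eps + 2 / n.+1%:R)) ^+ 2 <= eta ^+ 2.
    rewrite lerXn2r ?nnegrE ?mulr_ge0 ?addr_ge0 ?divr_ge0 ?(ltW eta0) ?(ltW eps0)//.
    apply: (@le_trans _ _ (D%:R * (eps + eps))); first by rewrite ler_wpM2l// lerD2l.
    rewrite /eps le_eqVlt; apply/orP; left; apply/eqP; field.
    by rewrite gt_eqF.
  have : eta ^+ 2 <= d.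
    rewrite expr2 -[leRHS]mul1r.
    by rewrite ler_pM ?(ltW eta0)// ge_min lexx ?orbT.
  by move=> etad le_eta /le_trans /(_ le_eta) /le_trans /(_ etad); move: d0; lra.
move=> x; have uE : u = (fun y => u (y - x) + u x).
  by apply/funext => y; rewrite -uD subrK.
rewrite /continuous_at [X in X @ _ --> _]uE -[X in _ --> X]add0r.
have cT := @add_continuous T (0, u x).
apply: (@continuous2_cvg _ _ _ _ _ _ (fun y => u (y - x)) (fun=> u x)
  (fun a b : T => a + b) 0 (u x) cT); last exact: cvg_cst.
apply: (cvg_comp (fun y => y - x) u _ u0).
by have := @translation_continuous K x x; rewrite /continuous_at subrr.
Qed.

End density.

(** * Separating a point from a countable subgroup by a sequence of characters *)

Theorem theorem1p2 (R : realType) (K : topologicalZmodType)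
    (compactK : compact [set: K]) (hausdorffK : hausdorff_space K)
    (H : set K) (subgroupH : zmod_closed [in H]) (countableH : countable H) :
  gclosed R H.
Proof.
rewrite /gclosed; apply/seteqP; split=> [x xcl|x Hx]; last by move=> u [_]; apply.
apply: contrapT => nHx.
have [chi [chiD chiH chix _]] := character_separation R subgroupH nHx.
have [h hH] : exists h : nat -> K, forall y, H y -> exists n, h n = y.
  have /countable_injP[g ginj] := countableH.
  (* Indices outside the range of [g] get the default [0]; only reaching every point of [H]
     matters. *)
  exists (fun n => xget 0 [set y | H y /\ g y = n]) => y Hy; exists (g y).
  have [Hz gz] : [set z | H z /\ g z = g y] (xget 0 [set z | H z /\ g z = g y]).
    by apply: xgetPex; exists y.
  by apply: ginj; rewrite ?inE.
(* Listing [x] each time forces [u n x] to tend to [chi x], while each point of [H] is listed from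
   some index on. *)
have app n : exists u : K -> circle R, dual u /\ forall g, g \in x :: mkseq h n ->
    2 - 2 * circle_cos (u g - chi g) <= (n.+1%:R^-1) ^+ 2.
  have [u du ug] := continuous_approximation compactK hausdorffK
    (x :: mkseq h n) chiD (ltn0Sn n).
  by exists u.
have [u uP] := choice app.
have limu y : (\forall n \near \oo, y \in x :: mkseq h n) ->
    u n y @[n --> \oo] --> chi y.
  move=> yh; rewrite (_ : (fun n => u n y) =
      (fun n => (u n y - chi y) + chi y)); last by apply/funext => n; rewrite subrK.
  rewrite -[X in _ --> X]add0r.
  apply: (@continuous2_cvg _ _ _ _ _ _ (fun n => u n y - chi y) (fun=> chi y)
    (fun a b : circle R => a + b) 0 (chi y)
    (@add_continuous _ (0, chi y))); last exact: cvg_cst.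
  move=> U /circle_nbhs0_cos[d d0 dU].
  suff : \forall n \near \oo, U (u n y - chi y) by [].
  near=> n; apply: dU; have [_ /(_ y)] := uP n; rewrite (near yh n)// => /(_ isT).
  have n0 : 0 < n.+1%:R^-1 :> R by rewrite invr_gt0.
  have n1 : n.+1%:R^-1 <= 1 :> R by rewrite invf_le1// ler1n.
  have nd : n.+1%:R^-1 < d by near: n; exact: near_infty_natSinv_lt (PosNum d0).
  have : n.+1%:R^-1 * n.+1%:R^-1 <= n.+1%:R^-1 :> R by rewrite ler_piMr// ltW.
  rewrite expr2 => aa ub; move: nd n0 aa ub.
  by move: (n.+1%:R^-1) (circle_cos _) => a cs ? ? ? ?; lra.
have uH : H `<=` s_set u.
  move=> y Hy /=; rewrite /s_set/= -(chiH y Hy); apply: limu.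
  have [k <-] := hH y Hy; exists k.+1 => // n /= kn.
  by rewrite inE [X in _ || X]map_f ?orbT// mem_iota.
have ux : u n x @[n --> \oo] --> (0 : circle R).
  by apply: (xcl u); split=> // n; have [] := uP n.
have ux' : u n x @[n --> \oo] --> chi x.
  by apply: limu; apply: nearW => n; rewrite mem_head.
(* The two limits of [u n x] are compared through the cosine, in [R]. *)
have cux : circle_cos (u n x) @[n --> \oo] --> circle_cos (0 : circle R).
  by apply: continuous_cvg ux; exact: circle_cos_continuous.
have cux' : circle_cos (u n x) @[n --> \oo] --> circle_cos (chi x).
  by apply: continuous_cvg ux'; exact: circle_cos_continuous.
have cos1 : circle_cos (chi x) = 1.
  by rewrite -(@circle_cos0 R); apply: (cvg_unique (@norm_hausdorff R R^o) cux' cux).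
by rewrite (circle_cos_eq1 cos1) eqxx in chix.
Unshelve. all: by end_near. Qed.
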